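(* Let $X^{f}$ be a $\ast\ast$-closed superreflexive class of finite equivalence, and let $E_X\in X^{f}$ be the corresponding separable space of almost universal disposition with respect to $\mathfrak{M}(X^{f})$. Then the conjugate space $(E_X)^{\ast}$ has the surjection property, i.e. for every (closed) subspace $V$ of $(E_X)^{\ast}$ there is a continuous linear surjection $(E_X)^{\ast}\to V$.
   Context: Finite representability: for Banach spaces $X,Y$, $X<_f Y$ means that for every $\varepsilon>0$ and every finite dimensional subspace $A$ of $X$ there are a subspace $B$ of $Y$ and an isomorphism $u:A\to B$ with $\|u\|\,\|u^{-1}\|\le 1+\varepsilon$. $X\sim_f Y$ means $X<_fY$ and $Y<_fX$; the class of finite equivalence of $X$ is $X^{f}=\{Y: X\sim_f Y\}$. Minkowski's base: $\mathfrak{M}$ is the set of all finite dimensional Banach spaces (isometric spaces identified), the disjoint union over $n$ of the sets $\mathfrak{M}_n$ of $n$-dimensional spaces, each with the metric $\log d$, $d$ the Banach–Mazur distance. $H(X)\subseteq\mathfrak{M}$ is the set of finite dimensional subspaces of $X$, and $\mathfrak{M}(X^{f})$ is the closure of $H(X)$ in $\mathfrak{M}$. It depends only on $X^{f}$ and determines $X^{f}$. Operations: for $K\subseteq\mathfrak{M}$, $H(K)$ is the set of all subspaces of members of $K$, $Q(K)$ is the set of all quotients of members of $K$, and $HQ(K)=H(Q(K))$. Let $l_2(X)$ be the $l_2$-sum of countably many copies of $X$ and $\mathsf{D}_2(X^{f})=(l_2(X))^{f}$. The class $\ast\ast(X^{f})$ is the class $W^{f}$ with $\mathfrak{M}(W^{f})=HQ\,\mathfrak{M}(\mathsf{D}_2(X^{f}))$.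 A class $X^{f}$ is $\ast\ast$-closed if $X^{f}=\ast\ast(W^{f})$ for some Banach space $W$. A class $X^{f}$ is superreflexive if every space in $X^{f}$ is reflexive (equivalently, every $Y<_fX$ is reflexive). Almost universal disposition: a Banach space $E$ is of almost universal disposition with respect to a class $\mathcal{K}$ of Banach spaces if for all $A,B\in\mathcal{K}$ with $A$ a subspace of $B$, every $\varepsilon>0$ and every isomorphic embedding $i:A\to E$ there is an isomorphic embedding $\hat\imath:B\to E$ with $\hat\imath|_A=i$ and $\|\hat\imath\|\,\|\hat\imath^{-1}\|\le(1+\varepsilon)\|i\|\,\|i^{-1}\|$ (inverses taken on the images). For a $\ast\ast$-closed class $X^{f}$, $E_X$ denotes a separable space belonging to $X^{f}$ which is of almost universal disposition with respect to $\mathfrak{M}(X^{f})$. *)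

(* Defs.v *)
From HB Require Import structures.
From mathcomp Require Import all_boot all_order all_algebra.
From mathcomp Require Import all_classical all_reals all_analysis.
From mathcomp Require Import ring lra.

Set Implicit Arguments.
Unset Strict Implicit.
Unset Printing Implicit Defensive.

Import Order.TTheory GRing.Theory Num.Theory.
Import numFieldNormedType.Exports.

Local Open Scope classical_set_scope.
Local Open Scope ring_scope.

Section OperatorNorm.
Context {R : realType}.

(* Meaningful for bounded maps only: [sup] is 0 on unbounded sets. *)
Definition opnorm (A E : normedModType R) (u : A -> E) : R :=
  sup [set `|u x| | x in [set x | `|x| <= 1]].

(* The norm of the inverse of [u], as a map from the image of [u] to [A]. *)
Definition inv_opnorm (A E : normedModType R) (u : A -> E) : R :=
  sup [set `|x| | x in [set x | `|u x| <= 1]].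

Definition distortion (A E : normedModType R) (u : A -> E) : R :=
  opnorm u * inv_opnorm u.

(* The second clause says that [u] is injective with bounded inverse on its
   image. *)
Definition iso_embedding (A E : normedModType R) (u : {linear A -> E}) : Prop :=
  continuous u /\ exists C : R, forall x, `|x| <= C * `|u x|.

Definition isomorphism (A B : normedModType R) (u : {linear A -> B}) : Prop :=
  iso_embedding u /\ range u = setT.

Definition isometric_embedding (A E : normedModType R) (j : {linear A -> E}) :
    Prop :=
  forall x, `|j x| = `|x|.

Lemma opnorm_has_sup (A E : normedModType R) (u : {linear A -> E}) :
  continuous u -> has_sup [set `|u x| | x in [set x | `|x| <= 1]].
Proof.
move=> uc; split; first by exists `|u 0|; exists 0 => //=; rewrite normr0.
have /linear_boundedP/pinfty_ex_gt0[M M0 Mu] : bounded_near u (nbhs 0).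
  exact/linear_bounded_continuous.
exists M => _ [x /= x1 <-]; rewrite (le_trans (Mu x))//.
by rewrite ler_piMr// ltW.
Qed.

Lemma opnorm_ub (A E : normedModType R) (u : {linear A -> E}) x :
  continuous u -> `|u x| <= opnorm u * `|x|.
Proof.
move=> uc; have [->|x0] := eqVneq x 0; first by rewrite linear0 !normr0 mulr0.
have nx : 0 < `|x| by rewrite normr_gt0.
rewrite -ler_pdivrMr//; apply: (sup_upper_bound (opnorm_has_sup uc)).
exists (`|x|^-1 *: x) => /=.
  by rewrite normrZ ger0_norm ?invr_ge0// mulVf// gt_eqF.
by rewrite linearZ/= normrZ ger0_norm ?invr_ge0// mulrC.
Qed.

End OperatorNorm.

Section Dual.
Context {R : realType} (E : normedModType R).

Definition bounded_functional : {pred E -> R^o} :=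
  fun f => `[< linear f /\ continuous f >].

Lemma bounded_functional_submod_closed : submod_closed bounded_functional.
Proof.
split.
  apply/asboolP; split; last exact: cst_continuous.
  by move=> a x y; rewrite scaler0 addr0.
move=> a f g /asboolP[lf cf] /asboolP[lg cg]; apply/asboolP; split.
  move=> b x y; change ((a *: f + g) (b *: x + y)) with
    (a *: f (b *: x + y) + g (b *: x + y)).
  change ((a *: f + g) x) with (a *: f x + g x).
  change ((a *: f + g) y) with (a *: f y + g y).
  by rewrite lf lg !scalerDr !scalerA [a * b]mulrC addrACA.
move=> x; apply: cvgD; last exact: cg.
by apply: cvgZl_tmp; exact: cf.
Qed.

HB.instance Definition _ := GRing.isSubmodClosed.Build R (E -> R^o)
  bounded_functional bounded_functional_submod_closed.

Record dual := Dual {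
  dual_fun :> E -> R^o ;
  dual_funP : dual_fun \in bounded_functional }.

HB.instance Definition _ := [isSub for dual_fun].
HB.instance Definition _ := [Choice of dual by <:].
HB.instance Definition _ := [SubChoice_isSubLmodule of dual by <:].

End Dual.

Section DualNorm.
Context {R : realType} (E : normedModType R).
Implicit Types f g : dual E.

Lemma dual_linear f : linear f.
Proof. by case: f => f /= /asboolP[]. Qed.

HB.instance Definition _ f :=
  GRing.isLinear.Build R E R^o *:%R (f : E -> R^o) (@dual_linear f).

Lemma dual_continuous f : continuous f.
Proof. by case: f => f /= /asboolP[]. Qed.

Lemma dualDE f g x : (f + g) x = f x + g x.
Proof. by []. Qed.

Lemma dualZE (a : R) f x : (a *: f) x = a * f x.
Proof. by []. Qed.

Definition dual_norm f : R := opnorm f.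

Lemma dual_norm_le f (M : R) :
  (forall x, `|x| <= 1 -> `|f x| <= M) -> dual_norm f <= M.
Proof.
move=> fM; apply: ge_sup; first by case: (opnorm_has_sup (@dual_continuous f)).
by move=> _ [x /= x1 <-]; exact: fM.
Qed.

Lemma dual_norm_ge f x : `|x| <= 1 -> `|f x| <= dual_norm f.
Proof.
move=> x1; apply: (sup_upper_bound (opnorm_has_sup (@dual_continuous f))).
by exists x.
Qed.

Lemma dual_normD f g : dual_norm (f + g) <= dual_norm f + dual_norm g.
Proof.
apply: dual_norm_le => x x1; rewrite dualDE (le_trans (ler_normD _ _))//.
by rewrite lerD// dual_norm_ge.
Qed.

Lemma dual_normZ (a : R) f : dual_norm (a *: f) = `|a| * dual_norm f.
Proof.
have nZ (b : R) (h : dual E) : dual_norm (b *: h) <= `|b| * dual_norm h.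
  apply: dual_norm_le => x x1.
  by rewrite dualZE normrM ler_wpM2l// dual_norm_ge.
apply/eqP; rewrite eq_le nZ/=; have [->|a0] := eqVneq a 0.
  rewrite normr0 mul0r (le_trans _ (dual_norm_ge _ (x := 0) _)) ?normr0//.
have := nZ a^-1 (a *: f).
by rewrite scalerA mulVf// scale1r normfV ler_pdivlMl// normr_gt0.
Qed.

Lemma dual_norm0_eq0 f : dual_norm f = 0 -> f = 0.
Proof.
move=> f0; apply/val_inj/funext => x /=.
have := opnorm_ub x (@dual_continuous f).
by rewrite -/(dual_norm f) f0 mul0r normr_le0 => /eqP.
Qed.

HB.instance Definition _ := Lmodule_isNormed.Build R (dual E)
  dual_normD dual_normZ dual_norm0_eq0.

End DualNorm.

Section L2Sum.
Context {R : realType} (X : completeNormedModType R).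
Implicit Types x y : nat -> X.

Definition sq_series x : R^nat := series (fun n => `|x n| ^+ 2).

Definition sq_summable : {pred nat -> X} := fun x => `[< cvgn (sq_series x) >].

Definition l2_val x : R := Num.sqrt (limn (sq_series x)).

Lemma sq_series_nd x : nondecreasing_seq (sq_series x).
Proof.
by apply/nondecreasing_seqP => n; rewrite /sq_series seriesSr lerDl exprn_ge0.
Qed.

Lemma sq_series_ge0 x n : 0 <= sq_series x n.
Proof. by rewrite /sq_series /series/= sumr_ge0// => i _; rewrite exprn_ge0. Qed.

Lemma sq_summable_bound x (M : R) :
  (forall n, sq_series x n <= M) -> x \in sq_summable.
Proof.
move=> xM; apply/asboolP; apply: nondecreasing_is_cvgn (sq_series_nd x) _.
by exists M => _ [n _ <-].
Qed.

Lemma sq_series_le x n : x \in sq_summable -> sq_series x n <= l2_val x ^+ 2.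
Proof.
move=> /asboolP cx; have le_lim := nondecreasing_cvgn_le (sq_series_nd x) cx.
by rewrite sqr_sqrtr// (le_trans (sq_series_ge0 x 0)).
Qed.

Lemma l2_val_ge0 x : 0 <= l2_val x.
Proof. exact: sqrtr_ge0. Qed.

Lemma l2_val_le x (M : R) : 0 <= M ->
  (forall n, sq_series x n <= M ^+ 2) -> l2_val x <= M.
Proof.
move=> M0 xM; rewrite /l2_val -[leRHS]ger0_norm// -sqrtr_sqr ler_wsqrtr//.
apply: limr_le; first by have /sq_summable_bound/asboolP := xM.
by near=> n; exact: xM.
Unshelve. all: by end_near. Qed.

Lemma le_l2_val x n : x \in sq_summable -> `|x n| <= l2_val x.
Proof.
move=> xs; rewrite -(@ler_pXn2r _ 2) ?nnegrE ?l2_val_ge0//.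
rewrite (le_trans _ (sq_series_le n.+1 xs))// /sq_series seriesSr lerDr.
exact: sq_series_ge0.
Qed.

Lemma sq_series_triangle x y (s t : R) n : 0 < s -> 0 < t ->
  sq_series x n <= s ^+ 2 -> sq_series y n <= t ^+ 2 ->
  sq_series (x + y) n <= (s + t) ^+ 2.
Proof.
move=> s0 t0 xs yt.
have E : (s + t) ^+ 2 = (1 + t / s) * s ^+ 2 + (1 + s / t) * t ^+ 2.
  by field; rewrite !gt_eqF.
rewrite E; apply: (@le_trans _ _
  ((1 + t / s) * sq_series x n + (1 + s / t) * sq_series y n)); last first.
  by rewrite lerD// ler_wpM2l// addr_ge0// divr_ge0// ltW.
rewrite /sq_series /series/= !mulr_sumr -big_split/=; apply: ler_sum => i _.
apply: (@le_trans _ _ ((`|x i| + `|y i|) ^+ 2)).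
  by rewrite ler_pXn2r ?nnegrE ?addr_ge0// ler_normD.
rewrite -subr_ge0.
have -> : (1 + t / s) * `|x i| ^+ 2 + (1 + s / t) * `|y i| ^+ 2 -
    (`|x i| + `|y i|) ^+ 2 = (t * `|x i| - s * `|y i|) ^+ 2 / (s * t).
  by field; rewrite !gt_eqF.
by rewrite divr_ge0 ?sqr_ge0// mulr_ge0// ltW.
Qed.

Lemma sq_seriesZ (a : R) x n :
  sq_series (a *: x) n = `|a| ^+ 2 * sq_series x n.
Proof.
rewrite /sq_series /series/= mulr_sumr; apply: eq_bigr => i _.
by rewrite -exprMn -normrZ.
Qed.

Lemma sq_summableD x y (e : R) n : 0 < e ->
  x \in sq_summable -> y \in sq_summable ->
  sq_series (x + y) n <= (l2_val x + l2_val y + e) ^+ 2.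
Proof.
move=> e0 xs ys; have e2 : 0 < e / 2 by rewrite divr_gt0.
have -> : l2_val x + l2_val y + e = (l2_val x + e / 2) + (l2_val y + e / 2).
  by field.
by apply: sq_series_triangle; rewrite ?ltr_wpDl ?l2_val_ge0//;
  rewrite (le_trans (sq_series_le n _))// ler_pXn2r ?nnegrE ?l2_val_ge0//
    ?addr_ge0 ?l2_val_ge0 ?lerDl// ltW.
Qed.

Lemma sq_summable_submod_closed : submod_closed sq_summable.
Proof.
split.
  apply: (@sq_summable_bound _ 0) => n.
  by rewrite /sq_series /series/= big1// => i _; rewrite normr0 expr0n.
move=> a x y xs ys.
have axs : a *: x \in sq_summable.
  apply: (@sq_summable_bound _ (`|a| ^+ 2 * l2_val x ^+ 2)) => n.
  by rewrite sq_seriesZ ler_wpM2l ?exprn_ge0// sq_series_le.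
by apply: sq_summable_bound => n; exact: (@sq_summableD _ _ 1).
Qed.

HB.instance Definition _ := GRing.isSubmodClosed.Build R (nat -> X)
  sq_summable sq_summable_submod_closed.

Record l2_sum := L2Sum {
  l2_seq :> nat -> X ;
  l2_seqP : l2_seq \in sq_summable }.

HB.instance Definition _ := [isSub for l2_seq].
HB.instance Definition _ := [Choice of l2_sum by <:].
HB.instance Definition _ := [SubChoice_isSubLmodule of l2_sum by <:].

End L2Sum.

Section L2Norm.
Context {R : realType} (X : completeNormedModType R).
Implicit Types x y : l2_sum X.

Definition l2_norm x : R := l2_val x.

Lemma l2_normD x y : l2_norm (x + y) <= l2_norm x + l2_norm y.
Proof.
apply/ler_addgt0Pr => e e0; apply: l2_val_le.
  by rewrite !addr_ge0 ?l2_val_ge0// ltW.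
by move=> n; apply: sq_summableD => //; exact: l2_seqP.
Qed.

Lemma l2_normZ (a : R) x : l2_norm (a *: x) = `|a| * l2_norm x.
Proof.
have nZ (b : R) (z : l2_sum X) : l2_norm (b *: z) <= `|b| * l2_norm z.
  apply: l2_val_le; first by rewrite mulr_ge0// l2_val_ge0.
  move=> n; rewrite (sq_seriesZ b z) exprMn ler_wpM2l ?exprn_ge0//.
  exact: sq_series_le (l2_seqP z).
apply/eqP; rewrite eq_le nZ/=; have [->|a0] := eqVneq a 0.
  by rewrite normr0 mul0r l2_val_ge0.
have := nZ a^-1 (a *: x).
by rewrite scalerA mulVf// scale1r normfV ler_pdivlMl// normr_gt0.
Qed.

Lemma l2_norm0_eq0 x : l2_norm x = 0 -> x = 0.
Proof.
move=> x0; apply/val_inj/funext => n /=.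
have := le_l2_val n (l2_seqP x).
by rewrite -/(l2_norm x) x0 normr_le0 => /eqP.
Qed.

HB.instance Definition _ := Lmodule_isNormed.Build R (l2_sum X)
  l2_normD l2_normZ l2_norm0_eq0.

Lemma l2_coord_le x n : `|x n| <= `|x|.
Proof. exact: le_l2_val (l2_seqP x). Qed.

Lemma l2_complete (F : set_system (l2_sum X)) :
  ProperFilter F -> cauchy F -> cvg F.
Proof.
move=> FF /cauchy_ballP Fc.
have coordB n x y : x n - y n = (x - y) n by [].
have coord_cvg n : cvg ((fun x => x n) @ F).
  apply/cauchy_cvgP/cauchy_ballP => e e0.
  have [[A B]/= [FA FB] AB] := Fc e e0.
  exists ((fun x => x n) @` A, (fun x => x n) @` B) => /=.
    by split; [apply: filterS FA|apply: filterS FB] => x ?; exists x.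
  move=> [_ _]/= [[x Ax <-] [y By <-]]; have := AB (x, y) (conj Ax By).
  rewrite -!ball_normE/= => xy; rewrite coordB.
  exact: le_lt_trans (l2_coord_le _ _) xy.
pose l n : X := lim ((fun x => x n) @ F).
have near_l (e : R) : 0 < e -> \forall x \near F,
    forall n, sq_series (l2_seq x - l) n <= e ^+ 2.
  move=> e0; have [[A B]/= [FA FB] AB] := Fc e e0.
  apply: filterS FA => x Ax n.
  have h : (fun y : l2_sum X => sq_series (x - y) n) @ F -->
      sq_series (l2_seq x - l) n.
    apply: (@cvg_big _ _ +%R) => [|k _]; first exact: add_continuous.
    have : (fun y : l2_sum X => `|x k - y k|) @ F --> `|x k - l k|.
      by apply: cvg_norm; apply: cvgB; [exact: cvg_cst|exact: coord_cvg].
    by move=> /(continuous_cvg _ (@exprn_continuous R 2 _)).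
  rewrite -(cvg_lim _ h)//; apply: limr_le; first by apply/cvg_ex; eexists; exact: h.
  apply: filterS FB => y By; rewrite (le_trans (sq_series_le n (l2_seqP (x - y))))//.
  rewrite ler_pXn2r ?nnegrE ?l2_val_ge0 ?(ltW e0)// ltW//.
  by have := AB (x, y) (conj Ax By); rewrite -ball_normE.
have lS : l \in @sq_summable R X.
  have [x xl] := filter_ex (near_l 1 ltr01).
  have -> : l = (x : nat -> X) - (l2_seq x - l).
    by rewrite opprB addrC subrK.
  apply: rpredB; first exact: l2_seqP.
  exact: sq_summable_bound xl.
apply/cvg_ex; exists (L2Sum lS); apply/cvgrPdist_le => e e0.
apply: filterS (near_l e e0) => x xl.
by rewrite distrC; apply: l2_val_le => //; exact: ltW.
Qed.

HB.instance Definition _ := Uniform_isComplete.Build (l2_sum X) l2_complete.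

End L2Norm.

Section FiniteEquivalence.
Context {R : realType}.
Notation banach := (completeNormedModType R).
Implicit Types (A B X Y Z W E : banach).

Definition has_dim A (n : nat) : Prop :=
  exists f : {linear 'rV[R]_n -> A}, bijective f.

Definition fin_dim A : Prop := exists n, has_dim A n.

(* Isometric spaces being identified, [A] is a subspace of [X] when it embeds
   isometrically into [X], and a quotient of [X] when it is isometric to
   [X / ker q] with its quotient norm. *)
Definition is_subspace A X : Prop :=
  exists j : {linear A -> X}, isometric_embedding j.

Definition is_quotient A X : Prop :=
  exists q : {linear X -> A}, range q = setT /\
    forall x, `|q x| = inf [set `|x - z| | z in [set z | q z = 0]].

Definition fd_subspaces X A : Prop := fin_dim A /\ is_subspace A X.

Definition finitely_representable X Y : Prop :=
  forall e : R, 0 < e -> forall A, fd_subspaces X A ->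
    exists u : {linear A -> Y}, iso_embedding u /\ distortion u <= 1 + e.

Definition finitely_equivalent X Y : Prop :=
  finitely_representable X Y /\ finitely_representable Y X.

Definition finite_class X : banach -> Prop :=
  fun Y => finitely_equivalent X Y.

(* Equal to 0 for zero spaces, and then [ln (banach_mazur A B)] is 0 too. *)
Definition banach_mazur A B : R :=
  inf [set distortion u | u in [set u : {linear A -> B} | isomorphism u]].

(* Subsets of Minkowski's base are represented by predicates on Banach spaces
   that imply [fin_dim]. *)
Definition minkowski_closure (K : banach -> Prop) A : Prop :=
  forall e : R, 0 < e ->
    exists B, K B /\ (exists n, has_dim A n /\ has_dim B n) /\
      ln (banach_mazur A B) < e.

Definition minkowski_base X : banach -> Prop :=
  minkowski_closure (fd_subspaces X).

Definition sub_op (K : banach -> Prop) A : Prop :=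
  exists B, K B /\ is_subspace A B.

Definition quot_op (K : banach -> Prop) A : Prop :=
  exists B, K B /\ is_quotient A B.

(* [Z^f = **(W^f)]: both sides depend only on the finite equivalence classes of
   [W] and [Z], and [minkowski_base Z] determines that of [Z]. *)
Definition is_star_star W Z : Prop :=
  forall A, minkowski_base Z A <->
    sub_op (quot_op (minkowski_base (l2_sum W))) A.

Definition star_star_closed (C : banach -> Prop) : Prop :=
  exists W Z, is_star_star W Z /\ forall Y, C Y <-> finite_class Z Y.

Definition reflexive_space (E : normedModType R) : Prop :=
  forall phi : dual (dual E), exists x : E, forall f : dual E, phi f = f x.

Definition superreflexive (C : banach -> Prop) : Prop :=
  forall Y, C Y -> reflexive_space Y.

Definition separable (E : normedModType R) : Prop :=
  exists2 D : set E, countable D & dense D.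

(* The zero space is excluded as [A]: with the convention that the zero map has
   norm 0, the distortion of its embeddings is 0 instead of 1. *)
Definition almost_universal_disposition (K : banach -> Prop) E : Prop :=
  forall A B, K A -> K B -> (exists a : A, a != 0) ->
  forall j : {linear A -> B}, isometric_embedding j ->
  forall e : R, 0 < e ->
  forall i : {linear A -> E}, iso_embedding i ->
    exists ihat : {linear B -> E}, [/\ iso_embedding ihat,
      forall a, ihat (j a) = i a &
      distortion ihat <= (1 + e) * distortion i].

Definition surjection_property (F : normedModType R) : Prop :=
  forall V : set F, submod_closed (mem V) -> closed V ->
    exists T : {linear F -> F}, continuous T /\ range T = V.

End FiniteEquivalence.

(* Main.v *)
From HB Require Import structures.
Require Import Defs.
From mathcomp Require Import all_boot all_order all_algebra.
From mathcomp Require Import all_classical all_reals all_analysis.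
From mathcomp Require Import ring lra.

(* Let K be the preannihilator of the closed subspace V of E^*. As E is
   reflexive, V is the annihilator of K, i.e. the dual of E / K, so that it
   suffices to embed E / K isomorphically into E: the adjoint of the
   embedding is then a surjection of E^* onto V. Every finite-dimensional
   subspace of E / K is almost isometric to a quotient of a finite-
   dimensional subspace of E, and M(X^f), being of the form HQ(...), is
   stable under quotients; hence M(X^f) contains the finite-dimensional
   subspaces of E / K. Since E / K is separable, the almost universal
   disposition of E extends an embedding of one line of E / K to a dense
   union of finite-dimensional subspaces with distortion less than 3. The
   quotient E / K and its embedding never appear as such: the embedding is
   represented by its graph pulled back to E * E, and functionals are
   transported along this graph with the Hahn-Banach theorem. *)

Set Implicit Arguments.
Unset Strict Implicit.
Unset Printing Implicit Defensive.

Import Order.TTheory GRing.Theory Num.Theory.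
Import numFieldNormedType.Exports.

Local Open Scope classical_set_scope.
Local Open Scope ring_scope.

(** * Bounded linear maps and the Hahn-Banach theorem *)

(** Phrased for plain sets, so that kernels, ranges, preannihilators and graphs in [E * E] are
    handled alike. *)
Definition subspace_of (R : realType) (M : lmodType R) (K : set M) : Prop :=
  K 0 /\ forall a x y, K x -> K y -> K (a *: x + y).

Definition linear_map (R : realType) (U V : lmodType R) (f : U -> V)
    (lf : linear f) : {linear U -> V} :=
  HB.pack f (GRing.isLinear.Build R U V *:%R f lf).

Section Subspace.
Context {R : realType} {M : lmodType R} {K : set M}.
Hypothesis Ksub : subspace_of K.

Lemma subspaceZ a x : K x -> K (a *: x).
Proof.
by case: Ksub => K0 KD Kx; rewrite -[a *: x]addr0; exact: KD.
Qed.

Lemma subspaceD x y : K x -> K y -> K (x + y).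
Proof. by case: Ksub => K0 KD Kx Ky; rewrite -[x]scale1r; exact: KD. Qed.

Lemma subspaceN x : K x -> K (- x).
Proof. by rewrite -scaleN1r; exact: subspaceZ. Qed.

End Subspace.

Section BoundedMaps.
Context {R : realType}.
Implicit Types A B M : normedModType R.

Lemma bounded_continuous A B (u : {linear A -> B}) (C : R) :
  (forall x, `|u x| <= C * `|x|) -> continuous u.
Proof.
move=> uC; apply/linear_bounded_continuous/linear_boundedP.
exists C; split=> [|r Cr x]; first exact: num_real.
by apply: le_trans (uC x) _; apply: ler_wpM2r => //; exact: ltW.
Qed.

Lemma bounded_iso_embedding A B (u : {linear A -> B}) (c C : R) :
  (forall x, `|u x| <= C * `|x|) -> (forall x, `|x| <= c * `|u x|) ->
  iso_embedding u.
Proof.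
by move=> uC uc; split; [exact: bounded_continuous uC|exists c].
Qed.

Lemma inv_opnorm_has_sup A B (u : {linear A -> B}) : iso_embedding u ->
  has_sup [set `|x| | x in [set x | `|u x| <= 1]].
Proof.
move=> [_ [C uC]]; split.
  by exists `|0 : A|, (0 : A) => //=; rewrite linear0 normr0.
exists `|C| => _ [x /= x1 <-]; rewrite (le_trans (uC x))//.
rewrite (le_trans (ler_norm _))// normrM normr_id ler_piMr//.
Qed.

Lemma inv_opnorm_ub A B (u : {linear A -> B}) x :
  iso_embedding u -> `|x| <= inv_opnorm u * `|u x|.
Proof.
move=> ue; have [_ [C uC]] := ue; have [->|x0] := eqVneq x 0.
  by rewrite linear0 !normr0 mulr0.
have nux : 0 < `|u x|.
  rewrite lt_neqAle normr_ge0 andbT eq_sym; apply: contra x0 => /eqP ux0.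
  by have := uC x; rewrite ux0 mulr0 normr_le0.
rewrite -ler_pdivrMr//; apply: (sup_upper_bound (inv_opnorm_has_sup ue)).
exists (`|u x|^-1 *: x) => /=; last first.
  by rewrite normrZ ger0_norm ?invr_ge0// mulrC.
by rewrite linearZ/= normrZ ger0_norm ?invr_ge0// mulVf// gt_eqF.
Qed.

Lemma opnorm_ge0 A B (u : {linear A -> B}) : continuous u -> 0 <= opnorm u.
Proof.
move=> uc; apply: (sup_upper_bound (opnorm_has_sup uc)).
by exists 0; rewrite /= ?linear0 normr0.
Qed.

Lemma inv_opnorm_ge0 A B (u : {linear A -> B}) :
  iso_embedding u -> 0 <= inv_opnorm u.
Proof.
move=> ue; apply: (sup_upper_bound (inv_opnorm_has_sup ue)).
by exists 0; rewrite /= ?linear0 normr0.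
Qed.

Lemma distortion_ge0 A B (u : {linear A -> B}) :
  iso_embedding u -> 0 <= distortion u.
Proof.
by move=> ue; rewrite mulr_ge0 ?inv_opnorm_ge0 ?opnorm_ge0//; case: ue.
Qed.

Lemma distortion_le A B (u : {linear A -> B}) (c C : R) : 0 <= c -> 0 <= C ->
  (forall x, `|u x| <= C * `|x|) -> (forall x, `|x| <= c * `|u x|) ->
  distortion u <= C * c.
Proof.
move=> c0 C0 uC uc; have ue := bounded_iso_embedding uC uc.
apply: ler_pM; rewrite ?inv_opnorm_ge0 ?opnorm_ge0//; first by case: ue.
  apply: ge_sup; first by case: (opnorm_has_sup ue.1).
  by move=> _ [x /= x1 <-]; rewrite (le_trans (uC x))// ler_piMr.
apply: ge_sup; first by case: (inv_opnorm_has_sup ue).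
by move=> _ [x /= x1 <-]; rewrite (le_trans (uc x))// ler_piMr.
Qed.

Lemma dual_ub A (f : dual A) x : `|f x| <= `|f| * `|x|.
Proof. exact: opnorm_ub (@dual_continuous _ _ f). Qed.

Lemma dual_norm_le_bound A (f : dual A) (C : R) : 0 <= C ->
  (forall x, `|f x| <= C * `|x|) -> `|f| <= C.
Proof.
move=> C0 fC; apply: dual_norm_le => x x1.
by rewrite (le_trans (fC x))// ler_piMr.
Qed.

Lemma ex_dual A (f : A -> R) (C : R) :
  (forall a x y, f (a *: x + y) = a * f x + f y) ->
  (forall x, `|f x| <= C * `|x|) -> exists g : dual A, forall x, g x = f x.
Proof.
move=> lf fC; have fP : (f : A -> R^o) \in @bounded_functional R A.
  apply/asboolP; split; first exact: lf.
  exact: (@bounded_continuous A R^o (@linear_map R A R^o f lf) C).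
by exists (Dual fP).
Qed.

End BoundedMaps.

Section HahnBanach.
Context {R : realType} (M : normedModType R) (C : R).
Hypothesis C0 : 0 <= C.

(** A partial functional is encoded by its graph. Single-valuedness follows from the domination: two
    values at a point differ by a value at 0, which is bounded by [C * 0]. *)
Definition dominated_graph (G : set (M * R)) : Prop :=
  [/\ G (0, 0),
    forall a x r y s, G (x, r) -> G (y, s) -> G (a *: x + y, a * r + s) &
    forall x r, G (x, r) -> r <= C * `|x|].

Lemma dominated_graphZ G a x r : dominated_graph G -> G (x, r) ->
  G (a *: x, a * r).
Proof.
case=> G0 GD _ Gx; have := GD a _ _ _ _ Gx G0.
by rewrite !addr0.
Qed.

Lemma dominated_graph_abs G x r :
  dominated_graph G -> G (x, r) -> `|r| <= C * `|x|.
Proof.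
move=> Gd Gx; have [_ _ Gb] := Gd; rewrite ler_norml (Gb _ _ Gx) andbT.
have /Gb := dominated_graphZ (-1) Gd Gx.
by rewrite scaleN1r normrN mulN1r lerNl.
Qed.

Lemma dominated_graph_fun G x r s :
  dominated_graph G -> G (x, r) -> G (x, s) -> r = s.
Proof.
move=> Gd Gr Gs; have [_ GD _] := Gd.
have := dominated_graph_abs Gd (GD (-1) _ _ _ _ Gr Gs).
by rewrite scaleN1r addNr normr0 mulr0 normr_le0 mulN1r addrC subr_eq0 => /eqP.
Qed.

(** The value [t] at [x0] has to lie above all [s - C * |y - x0|] and below all [C * |y + x0| - s].
    By the triangle inequality the former numbers never exceed the latter, so the supremum of the
    former will do. *)
Lemma dominated_graph_extend G x0 : dominated_graph G ->
  exists G', [/\ dominated_graph G', G `<=` G' & exists t, G' (x0, t)].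
Proof.
move=> Gd; have [G0 GD Gb] := Gd.
pose L : set R := [set p.2 - C * `|p.1 - x0| | p in G].
have Lub y s : G (y, s) -> ubound L (C * `|y + x0| - s).
  move=> Gy _ [[z r] /= Gz <-]; rewrite lerBlDr addrAC lerBrDr.
  rewrite (@le_trans _ _ (C * `|z + y|))//.
    by have := GD 1 _ _ _ _ Gz Gy; rewrite scale1r mul1r => /Gb.
  rewrite -mulrDr ler_wpM2l//.
  have -> : z + y = y + x0 + (z - x0) by rewrite addrACA subrr addr0 addrC.
  exact: ler_normD.
have Ls : has_sup L.
  by split; [exists (0 - C * `|0 - x0|), (0, 0)|
    exists (C * `|0 + x0| - 0); exact: Lub].
pose t := sup L.
have tL y s : G (y, s) -> s - C * `|y - x0| <= t.
  by move=> Gy; apply: (sup_upper_bound Ls); exists (y, s).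
have tU y s : G (y, s) -> t <= C * `|y + x0| - s.
  by move=> Gy; apply: ge_sup; [case: Ls|exact: Lub].
exists [set p | exists y s a, G (y, s) /\ p = (y + a *: x0, s + a * t)]; split.
- split.
  + by exists 0, 0, 0; rewrite scale0r mul0r !addr0.
  + move=> a _ _ _ _ [y [s [b [Gy [-> ->]]]]] [z [r [c [Gz [-> ->]]]]].
    exists (a *: y + z), (a * s + r), (a * b + c); split; first exact: GD.
    congr pair; last by ring.
    by rewrite scalerDr scalerDl scalerA addrACA.
  + move=> _ _ [y [s [b [Gy [-> ->]]]]].
    (* The coefficient of [x0] is scaled to 1 or -1 according to its sign; the upper bound on [t]
       serves for [b > 0], the lower one for [b < 0]. *)
    have [b0|b0|->] := ltgtP b 0; last first.
    * by rewrite scale0r mul0r !addr0 Gb.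
    * have := tU _ _ (dominated_graphZ b^-1 Gd Gy).
      rewrite lerBrDr -(ler_pM2l b0).
      have -> : b * (t + b^-1 * s) = s + b * t.
        by rewrite mulrDr mulrA divff ?gt_eqF// mul1r addrC.
      suff -> : b * (C * `|b^-1 *: y + x0|) = C * `|y + b *: x0| by [].
      rewrite mulrCA -[X in C * (X * _)]ger0_norm ?ltW// -normrZ scalerDr scalerA.
      by rewrite divff ?gt_eqF// scale1r.
    * have b0' : 0 < - b by rewrite oppr_gt0.
      have := tL _ _ (dominated_graphZ (- b)^-1 Gd Gy).
      rewrite lerBlDr -(ler_pM2l b0').
      have -> : - b * ((- b)^-1 * s) = s by rewrite mulrA divff ?gt_eqF// mul1r.
      have E : C * `|y + b *: x0| = - b * (C * `|(- b)^-1 *: y - x0|).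
        rewrite mulrCA -[X in C * (X * _)]ger0_norm ?ltW// -normrZ scalerDr scalerA.
        by rewrite divff ?gt_eqF// scale1r scalerN scaleNr opprK.
      rewrite E; move: (`| _ |) => w; lra.
- by move=> [y s] Gy; exists y, s, 0; rewrite scale0r mul0r !addr0.
- by exists t, 0, 0, 1; rewrite scale1r mul1r !add0r.
Qed.

Lemma hahn_banach_graph (G : set (M * R)) : dominated_graph G ->
  exists g : dual M, (forall x r, G (x, r) -> g x = r) /\
    forall x, `|g x| <= C * `|x|.
Proof.
move=> Gd.
(* Zorn's lemma is applied to the sets [A] whose union with [G] is dominated: the empty chain has
   the empty union, which is not a dominated graph by itself. *)
have [F FG Ftot|A [PA Amax]] := @Zorn_bigcup _ (fun A => dominated_graph (G `|` A)).
  have GD := Gd; have [G0 _ _] := Gd.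
  have both p q : (G `|` \bigcup_(X in F) X) p -> (G `|` \bigcup_(X in F) X) q ->
      (G p /\ G q) \/ exists X, [/\ F X, (G `|` X) p & (G `|` X) q].
    move=> [Gp|[X FX Xp]] [Gq|[Y FY Yq]];
      [by left|right; exists Y|right; exists X|right].
    - by split=> //; [left|right].
    - by split=> //; [right|left].
    - have [XY|YX] := Ftot _ _ FX FY.
        by exists Y; split=> //; right => //; exact: XY.
      by exists X; split=> //; right => //; exact: YX.
  split; first by left.
    move=> a x r y s xr ys; have [[Gx Gy]|[X [FX Xx Xy]]] := both _ _ xr ys.
      by left; case: Gd => _ + _; exact.
    have [_ XD _] := FG _ FX.
    by have [|] := XD a _ _ _ _ Xx Xy; [left|right; exists X].
  move=> x r [Gx|[X FX Xx]]; first by case: Gd => _ _; exact.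
  by have [_ _] := FG _ FX; apply; right.
have Ad : forall x, exists r, (G `|` A) (x, r).
  move=> x; have [G' [G'd GG' [t G't]]] := dominated_graph_extend x PA.
  apply: contrapT => nx; apply: (Amax G'); last first.
    suff -> : G `|` G' = G' by [].
    by apply/setUidPr => p Gp; apply: GG'; left.
  split; first by move=> p Ap; apply: GG'; right.
  by move=> /(_ _ G't) At; apply: nx; exists t; right.
have [f Gf] := choice Ad.
have fE x r : (G `|` A) (x, r) -> f x = r by apply: dominated_graph_fun (Gf x).
have [g gf] : exists g : dual M, forall x, g x = f x.
  apply: (@ex_dual R M f C) => [a x y|x]; last exact: dominated_graph_abs (Gf x).
  by apply: fE; case: PA => _ + _; apply.
exists g; split=> [x r Gx|x]; rewrite gf; first by apply: fE; left.
exact: dominated_graph_abs (Gf x).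
Qed.

End HahnBanach.

(** * Distance to a subspace and norms on row vectors *)

(** The quotient seminorm modulo [K], taken on [M] itself so that quotients of infinite-dimensional
    spaces need not be formed. *)
Definition qdist (R : realType) (M : normedModType R) (K : set M) (x : M) : R :=
  inf [set `|x - z| | z in K].

Section QuotientDistance.
Context {R : realType} {M : normedModType R} (K : set M).
Hypothesis Ksub : subspace_of K.

Lemma qdist_has_inf x : has_inf [set `|x - z| | z in K].
Proof.
by split; [exists `|x - 0|, 0 => //; case: Ksub|exists 0 => _ [z _ <-]].
Qed.

Lemma qdist_le x z : K z -> qdist K x <= `|x - z|.
Proof. by move=> Kz; apply: (inf_lbound (qdist_has_inf x).2); exists z. Qed.

Lemma le_qdist x (r : R) : (forall z, K z -> r <= `|x - z|) -> r <= qdist K x.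
Proof.
move=> h; apply: lb_le_inf; first by case: (qdist_has_inf x).
by move=> _ [z Kz <-]; exact: h.
Qed.

Lemma qdist_lt x (r : R) : qdist K x < r -> exists2 z, K z & `|x - z| < r.
Proof.
by move=> /(inf_lt (qdist_has_inf x).1)[_ [z Kz <-] zr]; exists z.
Qed.

Lemma qdist_ge0 x : 0 <= qdist K x.
Proof. by apply: le_qdist. Qed.

Lemma qdist_le_norm x : qdist K x <= `|x|.
Proof. by rewrite -[x in leRHS]subr0 qdist_le//; case: Ksub. Qed.

Lemma qdistD x y : qdist K (x + y) <= qdist K x + qdist K y.
Proof.
apply/ler_addgt0Pr => e e0.
have e2 : 0 < e / 2 by rewrite divr_gt0.
have [z Kz xz] : exists2 z, K z & `|x - z| < qdist K x + e / 2.
  by apply: qdist_lt; rewrite ltrDl.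
have [w Kw yw] : exists2 z, K z & `|y - z| < qdist K y + e / 2.
  by apply: qdist_lt; rewrite ltrDl.
rewrite (le_trans (qdist_le _ (subspaceD Ksub Kz Kw)))//.
rewrite opprD addrACA (le_trans (ler_normD _ _))//; move: xz yw.
by move: `|_| `|_| => a b; lra.
Qed.

Lemma qdistZ a x : qdist K (a *: x) = `|a| * qdist K x.
Proof.
have dZ b y : qdist K (b *: y) <= `|b| * qdist K y.
  have [->|b0] := eqVneq b 0.
    by rewrite normr0 mul0r scale0r (le_trans (qdist_le_norm _))// normr0.
  rewrite -ler_pdivrMl ?normr_gt0//; apply: le_qdist => z Kz.
  rewrite ler_pdivrMl ?normr_gt0// -normrZ scalerBr qdist_le//.
  exact: subspaceZ.
apply/eqP; rewrite eq_le dZ/=; have [->|a0] := eqVneq a 0.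
  by rewrite normr0 mul0r qdist_ge0.
have := dZ a^-1 (a *: x).
by rewrite scalerA mulVf// scale1r normfV ler_pdivlMl// normr_gt0.
Qed.

Lemma qdist_shift x z : K z -> qdist K (x + z) = qdist K x.
Proof.
have h y w : K w -> qdist K (y + w) <= qdist K y.
  move=> Kw; apply: le_qdist => v Kv.
  rewrite (le_trans (qdist_le _ (subspaceD Ksub Kv Kw)))//.
  by rewrite opprD addrACA subrr addr0.
move=> Kz; apply/eqP; rewrite eq_le h//=.
by rewrite -{1}[x](addrK z) h//; exact: subspaceN.
Qed.

Lemma qdist_lipschitz x y : `|qdist K x - qdist K y| <= `|x - y|.
Proof.
have h z w : qdist K z - qdist K w <= `|z - w|.
  rewrite lerBlDr (le_trans _ (lerD (qdist_le_norm _) (lexx _)))//.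
  by rewrite -{1}[z](subrK w) qdistD.
by rewrite ler_norml h andbT lerNl opprB distrC h.
Qed.

End QuotientDistance.

Lemma qdist_anti (R : realType) (M : normedModType R) (K L : set M) x :
  subspace_of K -> subspace_of L -> K `<=` L -> qdist L x <= qdist K x.
Proof.
by move=> Ks Ls KL; apply: le_qdist => // z /KL; exact: qdist_le.
Qed.

Lemma lipschitz_continuous_at (R : realType) (A B : normedModType R) (f : A -> B)
    (b : R) : (forall x y, `|f x - f y| <= b * `|x - y|) -> continuous f.
Proof.
move=> fb x; apply/cvgrPdist_lt => e e0.
have b1 : 0 < `|b| + 1 by rewrite ltr_wpDl.
near=> y; rewrite (le_lt_trans (fb _ _))//.
apply: (@le_lt_trans _ _ ((`|b| + 1) * `|x - y|)).
  by apply: ler_wpM2r => //; rewrite (le_trans (ler_norm b))// lerDl.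
rewrite -ltr_pdivlMl//; near: y; apply: cvgr_dist_lt => //.
by rewrite mulr_gt0// invr_gt0.
Unshelve. all: by end_near. Qed.

(** * Equivalence of norms on row vectors *)

Record norm_on (R : realType) (n : nat) := NormOn {
  norm_fun :> 'rV[R]_n -> R ;
  norm_onD : forall c d, norm_fun (c + d) <= norm_fun c + norm_fun d ;
  norm_onZ : forall a c, norm_fun (a *: c) = `|a| * norm_fun c ;
  norm_on_eq0 : forall c, norm_fun c = 0 -> c = 0 }.

Section NormEquivalence.
Context {R : realType} {n : nat}.
Implicit Types (N : norm_on R n) (c d : 'rV[R]_n).

Lemma norm_on0 N : N 0 = 0.
Proof. by rewrite -(scale0r 0) norm_onZ normr0 mul0r. Qed.

Lemma norm_onN N c : N (- c) = N c.
Proof. by rewrite -scaleN1r norm_onZ normrN1 mul1r. Qed.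

Lemma norm_on_ge0 N c : 0 <= N c.
Proof.
by have := norm_onD N c (- c); rewrite subrr norm_on0 norm_onN; lra.
Qed.

Lemma norm_on_sum N (I : Type) (r : seq I) (F : I -> 'rV[R]_n) :
  N (\sum_(i <- r) F i) <= \sum_(i <- r) N (F i).
Proof.
elim/big_ind2 : _ => [|c x d y cx dy|//]; first by rewrite norm_on0.
by rewrite (le_trans (norm_onD _ _ _))// lerD.
Qed.

Lemma mx_norm_coord c (i : 'I_n) : `|c 0 i| <= `|c|.
Proof.
rewrite [leRHS]/Num.Def.normr /= mx_normrE; apply/bigmax_geP; right => /=.
by exists (0, i).
Qed.

Lemma norm_on_bound N : exists2 b : R, 0 <= b & forall c, N c <= b * `|c|.
Proof.
exists (\sum_(i < n) N (delta_mx 0 i)) => [|c].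
  by rewrite sumr_ge0// => i _; exact: norm_on_ge0.
rewrite {1}[c]row_sum_delta (le_trans (norm_on_sum _ _ _))// mulr_suml.
apply: ler_sum => i _; rewrite norm_onZ mulrC ler_wpM2l ?norm_on_ge0//.
exact: mx_norm_coord.
Qed.

Lemma norm_on_dist N c d : `|N c - N d| <= N (c - d).
Proof.
have h x y : N x - N y <= N (x - y).
  by rewrite lerBlDr (le_trans _ (norm_onD _ _ _))// subrK.
by rewrite ler_norml h andbT lerNl opprB -[leRHS]norm_onN opprB h.
Qed.

Lemma norm_on_continuous N : continuous (N : 'rV[R]_n -> R).
Proof.
have [b b0 Nb] := norm_on_bound N.
apply: (@lipschitz_continuous_at R _ R^o _ b) => x y.
by rewrite (le_trans (norm_on_dist _ _ _)).
Qed.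

Definition unit_sphere : set 'rV[R]_n := [set c | `|c| = 1].

Lemma unit_sphere_compact : compact unit_sphere.
Proof.
apply: bounded_closed_compact.
  by exists 1; split => // r r1 c /= ->; exact: ltW.
have -> : unit_sphere = (fun c : 'rV[R]_n => `|c|) @^-1` [set 1] by [].
apply: closed_comp => [c _|]; first exact: norm_continuous.
exact: closed_eq.
Qed.

(** On the compact unit sphere [N] attains its minimum, which is positive; by homogeneity its
    inverse is the constant sought. *)
Lemma norm_on_lower N : exists2 a : R, 0 < a & forall c, `|c| <= a * N c.
Proof.
have Nn c : c != 0 -> exists2 d, unit_sphere d & c = `|c| *: d.
  move=> c0; exists (`|c|^-1 *: c).
    by rewrite /unit_sphere/= normrZ ger0_norm ?invr_ge0// mulVf// normr_eq0.
  by rewrite scalerA divff ?normr_eq0// scale1r.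
have [[c0 c01]|S0] := pselect (unit_sphere !=set0); last first.
  (* An empty sphere means [n = 0]: every vector is 0 and any constant works. *)
  exists 1 => // c; rewrite mul1r.
  have [->|/Nn[d d1 _]] := eqVneq c 0; first by rewrite normr0 norm_on_ge0.
  by exfalso; apply: S0; exists d.
have [//||m] := @EVT_min_rV R n N unit_sphere _ unit_sphere_compact.
- by exists c0.
- by apply: continuous_subspaceT; exact: norm_on_continuous.
rewrite inE => m1 mmin.
have m0 : 0 < N m.
  rewrite lt_neqAle norm_on_ge0 andbT eq_sym; apply/eqP => /norm_on_eq0 m0.
  by move: m1; rewrite /unit_sphere/= m0 normr0 => /esym/eqP; rewrite oner_eq0.
exists (N m)^-1; first by rewrite invr_gt0.
move=> c; have [->|/Nn[d d1 {2}->]] := eqVneq c 0.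
  by rewrite normr0 mulr_ge0 ?norm_on_ge0// invr_ge0 norm_on_ge0.
rewrite norm_onZ normr_id mulrCA ler_peMr//.
by rewrite -ler_pdivrMl ?invr_gt0// invrK mulr1 mmin// inE.
Qed.

End NormEquivalence.

(** A copy of the row vectors that carries the norm [N]; the parameter keeps the structures for
    different norms apart. *)
Definition normed_rV (R : realType) (n : nat) (N : norm_on R n) := 'rV[R]_n.

Section NormedRV.
Context {R : realType} {n : nat} (N : norm_on R n).

HB.instance Definition _ :=
  GRing.Lmodule.copy (normed_rV N) 'rV[R]_n.

HB.instance Definition _ := Lmodule_isNormed.Build R (normed_rV N)
  (norm_onD N) (norm_onZ N) (@norm_on_eq0 _ _ N).

Lemma normed_rVE (c : normed_rV N) : `|c| = N c.
Proof. by []. Qed.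

Lemma normed_rV_complete (F : set_system (normed_rV N)) :
  ProperFilter F -> cauchy F -> cvg F.
Proof.
move=> FF /cauchy_ballP Fc.
have [a a0 Na] := norm_on_lower N.
have [b b0 Nb] := norm_on_bound N.
(* [G] is the same filter, read in the sup norm, for which completeness is known. *)
pose G : set_system 'rV[R]_n := F.
have GG : ProperFilter G by [].
have Gc : cvg G.
  apply/cauchy_cvgP/cauchy_ballP => e e0.
  have ea0 : 0 < e / a by rewrite divr_gt0.
  have [[A B]/= [FA FB] AB] := Fc (e / a) ea0.
  exists (A, B) => //= -[x y]/= xy; have := AB (x, y) xy.
  rewrite -!ball_normE/= normed_rVE => h; rewrite (le_lt_trans (Na _))//.
  by rewrite -ltr_pdivlMl// mulrC.
apply/cvg_ex; exists (lim G : normed_rV N); apply/cvgrPdist_lt => e e0.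
have b1 : 0 < b + 1 by rewrite ltr_wpDl.
have /cvgrPdist_lt/(_ (e / (b + 1))) := Gc.
have eb : 0 < e / (b + 1) by rewrite divr_gt0.
move=> /(_ eb); apply: filterS => x xe; rewrite normed_rVE.
rewrite (le_lt_trans (Nb _))//.
apply: (@le_lt_trans _ _ ((b + 1) * `|(lim G : 'rV[R]_n) - x|)).
  by apply: ler_wpM2r => //; rewrite lerDl.
by rewrite -ltr_pdivlMl// mulrC.
Qed.

HB.instance Definition _ := Uniform_isComplete.Build (normed_rV N)
  normed_rV_complete.

Lemma normed_rV_has_dim : has_dim (normed_rV N) n.
Proof.
by exists (linear_map (fun a (x y : 'rV[R]_n) => erefl : (id _ : normed_rV N) = _));
  exists id.
Qed.

End NormedRV.

(** * Quotients of finite-dimensional spaces *)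

Section RowVectors.
Context {R : realType}.

(** [pi] puts coordinates on the quotient by [L], and [t] is a section of it. [L] is the row space
    of a matrix of largest rank among those with row space in [L], and the cokernel of this matrix
    provides [pi]. *)
Lemma rV_quotient p (L : set 'rV[R]_p) : subspace_of L ->
  exists r (pi : {linear 'rV[R]_p -> 'rV[R]_r})
      (t : {linear 'rV[R]_r -> 'rV[R]_p}),
    (forall c, pi (t c) = c) /\ forall c, L c <-> pi c = 0.
Proof.
move=> Ls; pose inL (A : 'M[R]_p) := forall u : 'rV_p, L (u *m A).
pose P k := `[< exists2 A, inL A & \rank A = k >].
have P0 : exists k, P k.
  exists 0%N; apply/asboolP; exists 0; last by rewrite mxrank0.
  by move=> u; rewrite mulmx0; case: Ls.
have Pub k : P k -> (k <= p)%N.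
  by move=> /asboolP[A _ <-]; exact: rank_leq_row.
have [_ /asboolP[A AL <-] Amax] := ex_maxnP P0 Pub.
have LA c : L c <-> (c <= A)%MS.
  split=> [Lc|/submxP[D ->]]; last exact: AL.
  (* Adding the row [c] to [A] keeps the row space inside [L], so maximality of the rank forces [c]
     into the row space of [A]. *)
  have BL : inL <<col_mx A c>>%MS.
    move=> u; have : (u *m <<col_mx A c>> <= col_mx A c)%MS.
      by rewrite (submx_trans (submxMl _ _))// genmxE.
    case/submxP => D ->; rewrite -[D]hsubmxK mul_row_col.
    apply: (subspaceD Ls); first exact: AL.
    by rewrite [rsubmx D]mx11_scalar mul_scalar_mx; exact: subspaceZ.
  have /Amax : P (\rank <<col_mx A c>>%MS).
    by apply/asboolP; exists <<col_mx A c>>%MS.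
  have AB : (A <= <<col_mx A c>>)%MS by rewrite genmxE -addsmxE addsmxSl.
  have := mxrank_leqif_sup AB; move=> /leqifP; case: ifP => [BA _ _|_ h h'].
    apply: submx_trans BA; rewrite genmxE -addsmxE; exact: addsmxSr.
  by have := leq_trans h h'; rewrite ltnn.
pose C := cokermx A.
(* Acting on row vectors, [C] and [col_base C] have the same kernel; the left inverse [B] gives the
   section. *)
have /row_fullP[B BC] : row_full (col_base C) by exact: col_base_full.
exists (\rank C), (linear_map (fun a x y => linearP (mulmxr (col_base C)) a x y)),
  (linear_map (fun a x y => linearP (mulmxr B) a x y)).
split=> c /=; first by rewrite -mulmxA BC mulmx1.
have CE : c *m C = c *m col_base C *m row_base C by rewrite -mulmxA mulmx_base.
rewrite LA submxE -/C CE; split=> [/eqP h|->]; last by rewrite mul0mx.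
by apply: (row_free_inj (row_base_free C)); rewrite h mul0mx.
Qed.

Lemma kernel_subspace (U V : lmodType R) (f : {linear U -> V}) :
  subspace_of [set x | f x = 0].
Proof.
by split=> [|a x y /= fx fy]; rewrite /= ?linear0// linearP fx fy scaler0 addr0.
Qed.

Lemma range_subspace (U V : lmodType R) (f : {linear U -> V}) :
  subspace_of (range f).
Proof.
split=> [|a _ _ [x _ <-] [y _ <-]]; first by exists 0 => //; rewrite linear0.
by exists (a *: x + y) => //; rewrite linearP.
Qed.

Lemma image_subspace (U V : lmodType R) (f : {linear U -> V}) K :
  subspace_of K -> subspace_of (f @` K).
Proof.
move=> [K0 KD]; split=> [|a _ _ [x Kx <-] [y Ky <-]].
  by exists 0 => //; rewrite linear0.
by exists (a *: x + y); [exact: KD|rewrite linearP].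
Qed.

(** Replaces a possibly redundant spanning family by coordinates on the range of [f]: [g] is the
    injective map induced on the quotient by the kernel. *)
Lemma linear_rV_factor p (V : lmodType R) (f : {linear 'rV[R]_p -> V}) :
  exists r (g : {linear 'rV[R]_r -> V}) (pi : {linear 'rV[R]_p -> 'rV[R]_r})
      (t : {linear 'rV[R]_r -> 'rV[R]_p}),
    [/\ injective g, forall c, g (pi c) = f c, forall c, f (t c) = g c &
        forall c, pi (t c) = c].
Proof.
have [r [pi [t [pit kpi]]]] := rV_quotient (kernel_subspace f).
have ker_sub c d : pi c = pi d -> f c = f d.
  move=> cd; apply/eqP; rewrite -subr_eq0 -linearB; apply/eqP.
  by apply/kpi; rewrite linearB /= cd subrr.
exists r, (linear_map (linearP (f \o t))), pi, t; split=> //= [c d /= cd|c].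
  rewrite -[c]pit -[d]pit; apply/eqP; rewrite -subr_eq0 -linearB; apply/eqP.
  by apply/kpi; rewrite /= linearB cd subrr.
by apply: ker_sub; rewrite pit.
Qed.

Definition lin_comb (V : lmodType R) m (k : 'I_m -> V) (c : 'rV[R]_m) : V :=
  \sum_(i < m) c 0 i *: k i.

Lemma lin_comb_linear (V : lmodType R) m (k : 'I_m -> V) : linear (lin_comb k).
Proof.
move=> a c d; rewrite /lin_comb scaler_sumr -big_split; apply: eq_bigr => i _ /=.
by rewrite !mxE scalerDl scalerA.
Qed.

Lemma lin_comb_delta (V : lmodType R) m (k : 'I_m -> V) i :
  lin_comb k (delta_mx 0 i) = k i.
Proof.
rewrite /lin_comb (bigD1 i)//= !mxE !eqxx scale1r big1 ?addr0// => j ji.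
by rewrite mxE (negbTE ji) andbF scale0r.
Qed.

Lemma linear_rV_bounded n (M : normedModType R) (f : {linear 'rV[R]_n -> M}) :
  exists2 b : R, 0 <= b & forall c, `|f c| <= b * `|c|.
Proof.
exists (\sum_(i < n) `|f (delta_mx 0 i)|); first by rewrite sumr_ge0.
move=> c; rewrite {1}[c]row_sum_delta linear_sum mulr_suml.
rewrite (le_trans (ler_norm_sum _ _ _))//; apply: ler_sum => i _.
by rewrite linearZ/= normrZ mulrC ler_wpM2l// mx_norm_coord.
Qed.

End RowVectors.

Section QuotientNorm.
Context {R : realType} (M : normedModType R) (n : nat).
Variables (s : {linear 'rV[R]_n -> M}) (K : set M).
Hypothesis Ksub : subspace_of K.
Hypothesis sK : forall c, qdist K (s c) = 0 -> c = 0.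

(** When [K] is closed, [sK] says that [s] is injective modulo [K]; the norm then models the span of
    [s] in [M / K]. *)
Definition quot_norm : norm_on R n.
Proof.
exists (fun c => qdist K (s c)) => //.
- by move=> c d; rewrite linearD; exact: qdistD.
- by move=> a c; rewrite linearZ; exact: qdistZ.
Defined.

Lemma quot_normE (c : normed_rV quot_norm) : `|c| = qdist K (s c).
Proof. by []. Qed.

End QuotientNorm.

Section ImageNorm.
Context {R : realType} (M : normedModType R) (n : nat).
Variables (s : {linear 'rV[R]_n -> M}).
Hypothesis s_inj : forall c, s c = 0 -> c = 0.

Definition image_norm : norm_on R n.
Proof.
exists (fun c => `|s c|).
- by move=> c d; rewrite linearD; exact: ler_normD.
- by move=> a c; rewrite linearZ; exact: normrZ.
- by move=> c /normr0_eq0; exact: s_inj.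
Defined.

Lemma image_normE (c : normed_rV image_norm) : `|c| = `|s c|.
Proof. by []. Qed.

End ImageNorm.

Section FiniteDimension.
Context {R : realType}.
Implicit Types A P X : completeNormedModType R.

Lemma inverse_linear (U V : lmodType R) (f : {linear U -> V}) :
  bijective f -> exists g : {linear V -> U}, cancel f g /\ cancel g f.
Proof.
move=> [g fg gf]; have lg : linear g.
  by move=> a x y; apply: (can_inj fg); rewrite linearP !gf.
by exists (linear_map lg).
Qed.

Lemma fin_dim_linear_bounded A (M : normedModType R) (f : {linear A -> M}) :
  fin_dim A -> exists2 b : R, 0 <= b & forall x, `|f x| <= b * `|x|.
Proof.
move=> [n [h hbij]]; have [g [hg gh]] := inverse_linear hbij.
have h0 c : h c = 0 -> c = 0 by move=> hc; rewrite -[c]hg hc linear0.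
have [a a0 ha] := norm_on_lower (image_norm h0).
have [b b0 fb] := linear_rV_bounded (linear_map (linearP (f \o h))).
exists (b * a); first by rewrite mulr_ge0// ltW.
move=> x; have /= := fb (g x); rewrite gh => /le_trans; apply.
by rewrite -mulrA ler_wpM2l//; have /= := ha (g x); rewrite gh.
Qed.

Lemma fin_dim_quotient A X : fin_dim X -> is_quotient A X -> fin_dim A.
Proof.
move=> [n [h hbij]] [q [qs _]]; have [k [hk kh]] := inverse_linear hbij.
have [r [g [pi [t [gi gpi ft _]]]]] :=
  linear_rV_factor (linear_map (linearP (q \o h))).
exists r, g.
have gsurj y : exists c, g c = y.
  have [x _ <-] : range q y by rewrite qs.
  by exists (pi (k x)); rewrite gpi/= kh.
have [g' gg'] := choice gsurj.
by exists g' => // c; apply: gi; rewrite gg'.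
Qed.

Lemma fin_dim_quotient_space P (L : set P) : fin_dim P -> subspace_of L ->
  exists (P' : completeNormedModType R) (pi : {linear P -> P'}),
    [/\ range pi = setT, forall x, `|pi x| = qdist L x &
        forall x, L x <-> pi x = 0].
Proof.
move=> Pfd Ls; have [n [h hbij]] := Pfd; have [k [hk kh]] := inverse_linear hbij.
have Ls' : subspace_of [set c | L (h c)].
  case: Ls => L0 LD; split=> [|a x y /= Lx Ly]; first by rewrite /= linear0.
  by rewrite linearP; exact: LD.
have [r [pi [t [pit kpi]]]] := rV_quotient Ls'.
pose pi0 : {linear P -> 'rV[R]_r} := linear_map (linearP (pi \o k)).
have Lpi x : L x <-> pi0 x = 0.
  by rewrite /= -kpi /= kh.
have [b b0 pib] := fin_dim_linear_bounded pi0 Pfd.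
(* [L] is closed: [pi0] is bounded and has the constant value [c] on the coset of [h (t c)], which
   contains arbitrarily small vectors when the distance is 0. *)
have sK c : qdist L (h (t c)) = 0 -> c = 0.
  move=> c0; have E z : L z -> pi0 (h (t c) - z) = c.
    by move=> /Lpi Lz; rewrite linearB Lz subr0 /= hk pit.
  apply/eqP; rewrite -normr_le0; apply/ler_addgt0Pr => e e0; rewrite add0r.
  have b1 : 0 < b + 1 by rewrite ltr_wpDl.
  have [z Lz ze] : exists2 z, L z & `|h (t c) - z| < e / (b + 1).
    by apply: qdist_lt => //; rewrite c0 divr_gt0.
  rewrite -(E z Lz) (le_trans (pib _))//.
  rewrite (@le_trans _ _ ((b + 1) * `|h (t c) - z|))//.
    by apply: ler_wpM2r => //; rewrite lerDl.
  by rewrite -ler_pdivlMl// mulrC ltW.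
pose s : {linear 'rV[R]_r -> P} := linear_map (linearP (h \o t)).
pose N := @quot_norm R P r s L Ls sK.
exists (normed_rV N), (pi0 : {linear P -> normed_rV N}); split=> //.
- by apply/seteqP; split=> // c _; exists (h (t c)) => //=; rewrite hk pit.
- move=> x; rewrite quot_normE.
  have Lx : L (h (t (pi (k x))) - x).
    by apply/Lpi; rewrite /= linearB hk linearB/= pit subrr.
  by rewrite -(qdist_shift Ls x Lx) addrC subrK.
Qed.

Lemma quotient_le A X (q : {linear X -> A}) x :
  (forall x, `|q x| = qdist [set z | q z = 0] x) -> `|q x| <= `|x|.
Proof. by move=> ->; apply: qdist_le_norm; exact: kernel_subspace. Qed.

(** If [Q] is the quotient of [F] by the kernel of [q], and [F] lies in [P], then [Q] sits in the
    quotient [P'] of [P] by the same kernel, and a quotient of [P] is a quotient of [X]. This makes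
    sets of the form HQ stable under quotients. *)
Lemma quotient_of_subspace_of_quotient (Q F P X : completeNormedModType R) :
  fin_dim X -> is_quotient Q F -> is_subspace F P -> is_quotient P X ->
  exists2 P', is_quotient P' X & is_subspace Q P'.
Proof.
move=> Xfd [q [qs qn]] [j jn] PX; have Pfd := fin_dim_quotient Xfd PX.
have [p [ps pn]] := PX.
have kq := kernel_subspace q; pose L := j @` [set x | q x = 0].
have Ls : subspace_of L by exact: image_subspace.
have [P' [pi [pis pin Lpi]]] := fin_dim_quotient_space Pfd Ls.
pose p' := linear_map (linearP (pi \o p)); have kp' := kernel_subspace p'.
exists P'.
  exists p'; split.
    apply/seteqP; split=> // y _.
    have [x _ xy] : range pi y by rewrite pis.
    have [z _ zx] : range p x by rewrite ps.
    by exists z => //=; rewrite zx.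
  move=> x; change (`|p' x| = qdist [set z | p' z = 0] x).
  apply/eqP; rewrite eq_le; apply/andP; split.
    apply: le_qdist => // z /= z0.
    have -> : pi (p x) = pi (p (x - z)) by rewrite !linearB/= z0 subr0.
    rewrite (le_trans (y := `|p (x - z)|))//; last exact: quotient_le.
    by rewrite pin qdist_le_norm.
  (* A point [l] of [L] is lifted to [w] in [X]; a point [z] of the kernel of [p] nearly closest to
     [x - w] makes [w + z] a competitor in the kernel of [p']. *)
  rewrite /= pin; apply: le_qdist => // l Ll.
  have [w _ wl] : range p l by rewrite ps.
  rewrite -wl -linearB pn; apply/ler_addgt0Pr => e e0.
  have [z pz0 /ltW] := qdist_lt (kernel_subspace p)
    (ltr_pwDr e0 (lexx (qdist [set z | p z = 0] (x - w)))).
  apply: le_trans; rewrite -addrA -opprD.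
  by apply: qdist_le => //=; rewrite linearD /= pz0 addr0 wl; exact/Lpi.
(* [t] is any set-theoretic section of [q]: another choice changes [j (t y)] by an element of [L],
   so the composite with [pi] is linear. *)
have qsurj y : exists x, q x = y.
  by have [x _ <-] : range q y by [rewrite qs]; exists x.
have [t qt] := choice qsurj.
have E x : pi (j (t (q x))) = pi (j x).
  apply/eqP; rewrite -subr_eq0 -!linearB; apply/eqP/Lpi.
  by exists (t (q x) - x) => //=; rewrite linearB qt subrr.
have lj : linear (fun y => pi (j (t y))).
  move=> a y z; rewrite -[y]qt -[z]qt -linearP !E.
  by rewrite !linearP.
exists (linear_map lj) => y /=; rewrite -[y]qt E pin qn.
apply/eqP; rewrite eq_le; apply/andP; split.
  apply: le_qdist => // z z0; rewrite -jn linearB; apply: qdist_le => //.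
  by exists z.
by apply: le_qdist => // _ [z z0 <-]; rewrite -linearB jn qdist_le.
Qed.

End FiniteDimension.

(** * Minkowski's base *)

Section MinkowskiBase.
Context {R : realType}.
Implicit Types A B X Y Z : completeNormedModType R.

Definition almost_embeds A Y : Prop :=
  forall e : R, 0 < e -> exists u : {linear A -> Y},
    forall x, `|x| <= `|u x| /\ `|u x| <= (1 + e) * `|x|.

(** Rescaling by [inv_opnorm u] makes 1 the lower bound and the distortion the upper one. *)
Lemma normalize_embedding (A Y : normedModType R) (u : {linear A -> Y}) (D : R) :
  iso_embedding u -> distortion u <= D ->
  exists w : {linear A -> Y}, forall x, `|x| <= `|w x| /\ `|w x| <= D * `|x|.
Proof.
move=> ue uD; have lw : linear (fun x => inv_opnorm u *: u x).
  by move=> a x y; rewrite linearP scalerDr !scalerA mulrC.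
exists (linear_map lw) => x /=.
rewrite normrZ ger0_norm ?inv_opnorm_ge0//; split; first exact: inv_opnorm_ub.
apply: (@le_trans _ _ (distortion u * `|x|)); last exact: ler_wpM2r.
rewrite /distortion mulrC -mulrA [X in _ <= _ * X]mulrC mulrA.
by rewrite ler_wpM2r ?inv_opnorm_ge0// opnorm_ub//; case: ue.
Qed.

(** Turns the range of [u] into a Banach space [B] of its own, since [minkowski_base] and
    [finitely_representable] speak of isometric subspaces. *)
Lemma image_model A Y n (u : {linear A -> Y}) : has_dim A n ->
  (forall x, `|x| <= `|u x|) ->
  exists B (v : {linear A -> B}) (j : {linear B -> Y}),
    [/\ has_dim B n, bijective v, isometric_embedding j & forall x, j (v x) = u x].
Proof.
move=> [h hbij] ux; have [k [hk kh]] := inverse_linear hbij.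
pose s : {linear 'rV[R]_n -> Y} := linear_map (linearP (u \o h)).
have s0 c : s c = 0 -> c = 0.
  move=> sc; rewrite -[c]hk; have := ux (h c); rewrite /= in sc.
  by rewrite sc normr0 normr_le0 => /eqP ->; rewrite linear0.
exists (normed_rV (image_norm s0)), k, s; split=> //.
- exact: normed_rV_has_dim.
- by exists h.
- by move=> x /=; rewrite kh.
Qed.

Lemma banach_mazur_le A B (v : {linear A -> B}) :
  isomorphism v -> banach_mazur A B <= distortion v.
Proof.
move=> vi; apply: inf_lbound; last by exists v.
by exists 0 => _ [w [we _] <-]; exact: distortion_ge0.
Qed.

(** Ensures that the infimum defining [banach_mazur] is taken over a nonempty set. *)
Lemma ex_isomorphism A B n : has_dim A n -> has_dim B n ->
  exists v : {linear A -> B}, isomorphism v.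
Proof.
move=> hA hB; have [f /inverse_linear[g [fg gf]]] := hA.
have [h /inverse_linear[k [hk kh]]] := hB.
pose v : {linear A -> B} := linear_map (linearP (h \o g)).
pose w : {linear B -> A} := linear_map (linearP (f \o k)).
have [b _ vb] := fin_dim_linear_bounded v (ex_intro _ n hA).
have [c _ wc] := fin_dim_linear_bounded w (ex_intro _ n hB).
exists v; split.
  apply: (bounded_iso_embedding vb) => x.
  by have := wc (v x); rewrite /= hk gf; exact.
by apply/seteqP; split=> // y _; exists (w y) => //=; rewrite fg kh.
Qed.

(** Eliminates [banach_mazur]: an isomorphism of small distortion onto a subspace, once rescaled, is
    a nearly isometric embedding, and conversely the range of such an embedding is a nearby
    subspace. *)
Lemma minkowski_baseP A Y : minkowski_base Y A <-> fin_dim A /\ almost_embeds A Y.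
Proof.
split=> [AY|[[n hA] AY] e e0].
  split; first by have [B [_ [[n [hA _]] _]]] := AY 1 ltr01; exists n.
  move=> e e0; have e1 : 0 < ln (1 + e) by rewrite ln_gt0// ltrDl.
  have [B [[_ [j jn]] [[n [hA hB]] bm]]] := AY _ e1.
  have bmlt : banach_mazur A B < 1 + e.
    (* The logarithm of a nonpositive number is 0 by convention, so this case is separated. *)
    have [bm0|bm0] := leP (banach_mazur A B) 0.
      by rewrite (le_lt_trans bm0)// addr_gt0.
    by rewrite -ltr_ln ?posrE ?addr_gt0.
  have [v0 v0i] := ex_isomorphism hA hB.
  have [_ [v [ve _] <-] vlt] : exists2 x, [set distortion u | u in
      [set u : {linear A -> B} | isomorphism u]] x & x < 1 + e.
    by apply: inf_lt bmlt; exists (distortion v0), v0.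
  have [w wP] := normalize_embedding ve (ltW vlt).
  by exists (linear_map (linearP (j \o w))) => x /=; rewrite jn.
(* With this tolerance the distortion is at most [expR (e / 2)], whose logarithm is below [e]. *)
have d0 : 0 < expR (e / 2) - 1 by rewrite subr_gt0 expR_gt1 divr_gt0.
have [u uP] := AY _ d0.
have [B [v [j [hB vbij jn jv]]]] := image_model hA (fun x => (uP x).1).
exists B; split; first by split; [exists n|exists j].
split; first by exists n.
have vl x : `|x| <= 1 * `|v x| by rewrite mul1r -jn jv (uP x).1.
have vu x : `|v x| <= expR (e / 2) * `|x|.
  by rewrite -jn jv (le_trans (uP x).2)// addrC subrK.
have vi : isomorphism v.
  split; first exact: bounded_iso_embedding vu vl.
  by case: vbij => w _ wv; apply/seteqP; split=> // y _; exists (w y).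
have := le_trans (banach_mazur_le vi) (distortion_le ler01 (expR_ge0 _) vu vl).
rewrite mulr1 => bm; have [bm0|bm0] := leP (banach_mazur A B) 0.
  by rewrite ln0.
rewrite (@le_lt_trans _ _ (e / 2))//; last by rewrite ltr_pdivrMr// ltr_pMr// ltr1n.
by rewrite -[leRHS]expRK ler_ln// posrE expR_gt0.
Qed.

(** Serves to compose two nearly isometric embeddings. As [d = e / (3 + e)] is less than 1, the
    square of [1 + d] is at most [1 + 3 * d], hence at most [1 + e]. *)
Lemma square_margin (e : R) : 0 < e ->
  exists2 d : R, 0 < d & (1 + d) * (1 + d) <= 1 + e.
Proof.
move=> e0; exists (e / (3 + e)); first by rewrite divr_gt0// addr_gt0.
have e3 : 0 < 3 + e by rewrite addr_gt0.
have -> : (1 + e / (3 + e)) * (1 + e / (3 + e)) =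
    1 + e - (e * (3 + 3 * e + e ^+ 2)) / (3 + e) ^+ 2.
  by field; rewrite gt_eqF.
rewrite lerBlDr lerDl divr_ge0 ?sqr_ge0// mulr_ge0 ?ltW//.
by rewrite !addr_gt0 ?mulr_gt0 ?exprn_gt0.
Qed.

Lemma almost_embeds_comp A X Y : fin_dim A -> finitely_representable X Y ->
  almost_embeds A X -> almost_embeds A Y.
Proof.
move=> [n hA] XY AX e e0; have [d d0 de] := square_margin e0.
have [u uP] := AX d d0.
have [B [v [j [hB _ jn jv]]]] := image_model hA (fun x => (uP x).1).
have [w0 [w0e w0d]] := XY d d0 B (conj (ex_intro _ n hB) (ex_intro _ j jn)).
have [w wP] := normalize_embedding w0e w0d.
have vE x : `|v x| = `|u x| by rewrite -jn jv.
exists (linear_map (linearP (w \o v))) => x /=; split.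
  by rewrite (le_trans (uP x).1)// -vE (wP _).1.
rewrite (le_trans (wP _).2)// vE (le_trans (y := (1 + d) * ((1 + d) * `|x|)))//.
  by rewrite ler_wpM2l ?(uP x).2// addr_ge0// ltW.
by rewrite mulrA ler_wpM2r.
Qed.

Lemma minkowski_base_representable A X Y : finitely_representable X Y ->
  minkowski_base X A -> minkowski_base Y A.
Proof.
move=> XY /minkowski_baseP[Afd AX]; apply/minkowski_baseP.
by split=> //; exact: almost_embeds_comp XY AX.
Qed.

Lemma finitely_equivalent_refl X : finitely_equivalent X X.
Proof.
suff h : finitely_representable X X by split.
move=> e e0 A [Afd [j jn]]; exists j.
have jl x : `|x| <= 1 * `|j x| by rewrite mul1r jn.
have ju x : `|j x| <= 1 * `|x| by rewrite mul1r jn.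
split; first exact: bounded_iso_embedding ju jl.
by rewrite (le_trans (distortion_le ler01 ler01 ju jl))// mulr1 lerDl ltW.
Qed.

End MinkowskiBase.

(** * Quotients of the space in Minkowski's base *)

Section Approximation.
Context {R : realType} (M : normedModType R) (n : nat).
Variables (s : {linear 'rV[R]_n -> M}) (K : set M).
Hypothesis Ksub : subspace_of K.
Hypothesis sK : forall c, qdist K (s c) = 0 -> c = 0.

(** A compactness argument: a point of [K] nearly closest to [s d] still serves [s c] for [c] close
    to [d], so finitely many points of [K] suffice on the unit sphere, and their span suffices
    everywhere by homogeneity. *)
Lemma quotient_norm_approx (e : R) : 0 < e ->
  exists m (k : {linear 'rV[R]_m -> M}), range k `<=` K /\
    forall c, qdist (range k) (s c) <= (1 + e) * qdist K (s c).
Proof.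
move=> e0; have [b b0 sb] := linear_rV_bounded s.
have spos c : c != 0 -> 0 < qdist K (s c).
  move=> c0; rewrite lt_neqAle qdist_ge0// andbT eq_sym.
  by apply: contra c0 => /eqP/sK ->.
(* Nothing is asked at [d = 0], where the strict inequality cannot hold. *)
have near_k (d : 'rV[R]_n) :
    exists z, K z /\ (d != 0 -> `|s d - z| < (1 + e) * qdist K (s d)).
  have [->|d0] := eqVneq d 0; first by exists 0; split=> //; case: Ksub.
  have [z Kz zd] : exists2 z, K z & `|s d - z| < (1 + e) * qdist K (s d).
    by apply: qdist_lt => //; rewrite ltr_pMl ?spos// ltrDl.
  by exists z.
have [k kP] := choice near_k.
pose U d := [set c : 'rV[R]_n | `|s c - k d| < (1 + e) * qdist K (s c)].
have Uop d : open (U d).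
  pose h (c : 'rV[R]_n) : R^o := (1 + e) * qdist K (s c) - `|s c - k d|.
  have -> : U d = h @^-1` [set r | 0 < r].
    by apply/seteqP; split=> c; rewrite /U/= /h subr_gt0.
  apply: open_comp; last exact: open_gt.
  move=> c _; move: c.
  apply: (@lipschitz_continuous_at R _ R^o _ ((1 + e) * b + b)) => x y.
  have -> : h x - h y = (1 + e) * (qdist K (s x) - qdist K (s y)) -
      (`|s x - k d| - `|s y - k d|) by rewrite /h; ring.
  rewrite (le_trans (ler_normB _ _))// [leRHS]mulrDl; apply: lerD.
    have e1 : 0 <= 1 + e by rewrite addr_ge0// ltW.
    rewrite normrM (ger0_norm e1) -mulrA; apply: ler_wpM2l => //.
    by rewrite (le_trans (qdist_lipschitz Ksub _ _))// -linearB.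
  rewrite (le_trans (ler_dist_dist _ _))// opprB addrA subrK.
  by rewrite -linearB.
have SU : @unit_sphere R n `<=` cover setT U.
  move=> c c1; exists c => //; apply: (kP c).2.
  apply/eqP => c0; move: c1; rewrite /unit_sphere/= c0 normr0 => /esym/eqP.
  by rewrite oner_eq0.
have := @unit_sphere_compact R n; rewrite compact_cover.
move=> /(_ _ setT U (fun d _ => Uop d) SU)[D _ DS].
pose f (i : 'I_(size (finmap.enum_fset D))) := k (nth 0 (finmap.enum_fset D) i).
exists _, (linear_map (lin_comb_linear f)); set kk := linear_map _.
have rs := range_subspace kk.
split=> [_ [c _ <-]/=|c].
  rewrite /lin_comb; elim/big_ind : _ => [|x y Kx Ky|i _]; first by case: Ksub.
    exact: subspaceD.
  by apply: subspaceZ => //; exact: (kP _).1.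
have [->|c0] := eqVneq c 0.
  rewrite linear0 (le_trans (qdist_le_norm rs 0))// normr0.
  by rewrite mulr_ge0 ?qdist_ge0// addr_ge0// ltW.
have [|d Dd Ud] := DS (`|c|^-1 *: c).
  by rewrite /unit_sphere/= normrZ ger0_norm ?invr_ge0// mulVf// normr_eq0.
have nc : 0 < `|c| by rewrite normr_gt0.
have -> : c = `|c| *: (`|c|^-1 *: c) by rewrite scalerA divff ?gt_eqF// scale1r.
rewrite linearZ !qdistZ// normr_id mulrCA ler_wpM2l//.
rewrite (le_trans _ (ltW Ud))//; apply: qdist_le => //.
have id : (index d (finmap.enum_fset D) < size (finmap.enum_fset D))%N.
  by rewrite index_mem.
exists (delta_mx 0 (Ordinal id)) => //=; rewrite lin_comb_delta /f nth_index//.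
Qed.

End Approximation.

Section QuotientsInMinkowskiBase.
Context {R : realType} (W X Z E : completeNormedModType R).
Hypothesis WZ : is_star_star W Z.
Hypothesis XZ : finitely_equivalent X Z.
Hypothesis EX : finitely_representable E X.

(** [X] and [Z] have the same Minkowski base, which is HQ of the base of [l2_sum W]; a quotient of a
    subspace of a quotient is again a subspace of a quotient. *)
Lemma quotient_mem_minkowski_base F Q :
  minkowski_base X F -> is_quotient Q F -> minkowski_base X Q.
Proof.
move=> XF QF; apply: (minkowski_base_representable XZ.2); apply/WZ.
have /WZ[P [[B [BW BP]] FP]] := minkowski_base_representable XZ.1 XF.
have [P' P'B QP'] := quotient_of_subspace_of_quotient
  ((minkowski_baseP _ _).1 BW).1 QF FP BP.
by exists P'; split=> //; exists B.
Qed.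

(** The space is the quotient by [range k] of the sum [F] of the ranges of [s] and [k], a
    finite-dimensional subspace of [E]. *)
Lemma finite_quotient_mem_minkowski_base n m (s : {linear 'rV[R]_n -> E})
    (k : {linear 'rV[R]_m -> E})
    (sk : forall c, qdist (range k) (s c) = 0 -> c = 0) :
  minkowski_base X (normed_rV (quot_norm (range_subspace k) sk)).
Proof.
have rs := range_subspace k.
have lphi : linear (fun c : 'rV[R]_(n + m) => s (lsubmx c) + k (rsubmx c)).
  by move=> a c d; rewrite !linearP/= scalerDr addrACA.
have [r [g [pi [t [gi gpi phit pit]]]]] := linear_rV_factor (linear_map lphi).
have g0 c : g c = 0 -> c = 0 by move=> gc; apply: gi; rewrite gc linear0.
set Q := normed_rV _; pose F : completeNormedModType R := normed_rV (image_norm g0).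
(* [q] sends a vector of [F] to its [s]-component; by [sk] this does not depend on how the vector is
   written as [s a + k b]. *)
have lq : linear (fun c : F => lsubmx (t c) : Q).
  by move=> a c d; rewrite linearP; exact: linearP.
pose q := linear_map lq.
have gE (c : F) : g c = s (q c) + k (rsubmx (t c)) by rewrite -phit.
have qE (c : F) a b : g c = s a + k b -> q c = a.
  rewrite gE => E1; apply/eqP; rewrite -subr_eq0; apply/eqP/sk.
  have -> : s (q c - a) = k (b - rsubmx (t c)).
    rewrite !linearB/=; apply/eqP; rewrite subr_eq.
    rewrite addrAC eq_sym subr_eq addrC eq_sym.
    by rewrite E1 addrC.
  apply/eqP; rewrite eq_le qdist_ge0// andbT.
  have kr : range k (k (b - rsubmx (t c))) by exists (b - rsubmx (t c)).
  by have := qdist_le rs (k (b - rsubmx (t c))) kr; rewrite subrr normr0.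
have phiE a b : g (pi (row_mx a b)) = s a + k b by rewrite gpi/= row_mxKl row_mxKr.
apply: (@quotient_mem_minkowski_base F).
  apply: (minkowski_base_representable EX); apply/minkowski_baseP.
  split; first by exists r; exact: normed_rV_has_dim.
  move=> e e0; exists g => c; split=> //.
  by rewrite ler_peMl// lerDl ltW.
exists q; split.
  apply/seteqP; split=> // a _; exists (pi (row_mx a 0)) => //.
  by apply: (qE _ _ 0); exact: phiE.
move=> c; change (`|q c| = qdist [set z | q z = 0] c).
have kq := kernel_subspace q.
have -> : `|q c| = qdist (range k) (g c).
  rewrite gE qdist_shift//; by exists (rsubmx (t c)).
apply/eqP; rewrite eq_le; apply/andP; split.
  apply: le_qdist => // z z0; rewrite image_normE linearB; apply: qdist_le => //.
  by rewrite gE (z0 : q z = 0) linear0 add0r; exists (rsubmx (t z)).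
apply: le_qdist => // _ [b _ <-].
have -> : g c - k b = g (c - pi (row_mx 0 b)).
  by rewrite linearB/= phiE linear0 add0r.
apply: (qdist_le kq) => /=; apply: (qE _ _ b); exact: phiE.
Qed.

(** [K] is replaced by a finite-dimensional subspace of it, which raises the norm by a factor of at
    most [1 + d]; a nearly isometric embedding for the larger norm is then one for the smaller norm
    too. *)
Lemma quot_norm_mem_minkowski_base n (s : {linear 'rV[R]_n -> E}) (K : set E)
    (Ksub : subspace_of K) (sK : forall c, qdist K (s c) = 0 -> c = 0) :
  minkowski_base X (normed_rV (quot_norm Ksub sK)).
Proof.
apply/minkowski_baseP; split; first by exists n; exact: normed_rV_has_dim.
move=> e e0; have [d d0 de] := square_margin e0.
have [m [k [kK kd]]] := quotient_norm_approx Ksub sK d0.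
have rs := range_subspace k.
have sk c : qdist (range k) (s c) = 0 -> c = 0.
  move=> h; apply: sK; apply/eqP; rewrite eq_le qdist_ge0// andbT -h.
  exact: qdist_anti.
have /minkowski_baseP[_ /(_ d d0)[u uP]] := finite_quotient_mem_minkowski_base sk.
exists (u : {linear 'rV[R]_n -> X}) => c; rewrite quot_normE; split.
  by rewrite (le_trans (qdist_anti _ rs Ksub kK))// (uP c).1.
rewrite (le_trans (uP c).2)// quot_normE.
apply: (@le_trans _ _ ((1 + d) * ((1 + d) * qdist K (s c)))).
  by rewrite ler_wpM2l// addr_ge0// ltW.
by rewrite mulrA ler_wpM2r// qdist_ge0.
Qed.

End QuotientsInMinkowskiBase.

(** * Embedding a quotient and transporting functionals *)

Section EmbeddingTheQuotient.
Context {R : realType} (E : completeNormedModType R) (K : set E).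
Variables (C : completeNormedModType R -> Prop) (x0 : E).
Hypothesis Ksub : subspace_of K.
Hypothesis Kclosed : forall x, qdist K x = 0 -> K x.
Hypothesis C_quot : forall n (s : {linear 'rV[R]_n -> E})
  (sK : forall c, qdist K (s c) = 0 -> c = 0), C (normed_rV (quot_norm Ksub sK)).
Hypothesis C_embeds : forall A, C A -> almost_embeds A E.
Hypothesis C_disposition : almost_universal_disposition C E.
Hypothesis x0K : ~ K x0.

(* [s] spans a finite-dimensional subspace of [E / K], [i] embeds it in [E],
   and [G] is the graph of [i] pulled back to [E]. Fixing the image of [x0]
   turns the bound on the distortion of [i] into bounds on both norms. *)
Definition partial_embedding (z0 : E) (G : set (E * E)) : Prop :=
  exists n (s : {linear 'rV[R]_n -> E}) (sK : forall c, qdist K (s c) = 0 -> c = 0)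
    (i : {linear normed_rV (quot_norm Ksub sK) -> E}),
    [/\ iso_embedding i, distortion i < 3,
      exists2 a : normed_rV (quot_norm Ksub sK), s a = x0 & i a = z0 &
      forall x z, G (x, z) <->
        exists2 a : normed_rV (quot_norm Ksub sK), K (x - s a) & z = i a].

Lemma partial_embedding_linear z0 G : partial_embedding z0 G -> subspace_of G.
Proof.
move=> [n [s [sK [i [_ _ _ Gi]]]]]; split=> [|a [x z] [x' z']].
  apply/Gi; exists 0; last by rewrite linear0.
  by rewrite linear0 subr0; case: Ksub.
move=> /Gi[c Kc ->] /Gi[c' Kc' ->]; apply/Gi; exists (a *: c + c').
  rewrite linearP opprD addrACA -scalerBr; exact: Ksub.2.
by rewrite linearP.
Qed.

Lemma partial_embedding0 z0 G k : partial_embedding z0 G -> K k -> G (k, 0).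
Proof.
move=> [n [s [sK [i [_ _ _ Gi]]]]] Kk; apply/Gi.
by exists 0; [rewrite linear0 subr0|rewrite linear0].
Qed.

(** As [i] sends a vector of norm [qdist K x0] to [z0], both [opnorm i] and [inv_opnorm i] are
    bounded below; their product is less than 3, so both are bounded above. The constant depends on
    [x0] and [z0] alone, hence survives the passage to a union. *)
Lemma partial_embedding_bounds z0 G : partial_embedding z0 G ->
  let D := 3 * (`|z0| / qdist K x0 + qdist K x0 / `|z0|) in
  forall x z, G (x, z) -> `|z| <= D * qdist K x /\ qdist K x <= D * `|z|.
Proof.
move=> [n [s [sK [i [ie id [a0 sa0 ia0] Gi]]]]] D.
have x0pos : 0 < qdist K x0.
  by rewrite lt_neqAle qdist_ge0// andbT eq_sym; apply/eqP => /Kclosed.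
have a0n : `|a0| = qdist K x0 by rewrite quot_normE sa0.
have iu a : `|i a| <= opnorm i * `|a| by apply: opnorm_ub; case: ie.
have il a : `|a| <= inv_opnorm i * `|i a| by exact: inv_opnorm_ub.
have ou : 0 <= opnorm i by apply: opnorm_ge0; case: ie.
have ov : 0 <= inv_opnorm i by exact: inv_opnorm_ge0.
have z0pos : 0 < `|z0|.
  rewrite lt_neqAle normr_ge0 andbT eq_sym; apply/eqP => z00.
  by have := il a0; rewrite ia0 z00 mulr0 a0n leNgt x0pos.
have l0 : qdist K x0 <= inv_opnorm i * `|z0| by have := il a0; rewrite ia0 a0n.
have u0 : `|z0| <= opnorm i * qdist K x0 by have := iu a0; rewrite ia0 a0n.
have q1 : 0 <= `|z0| / qdist K x0 by rewrite divr_ge0// ltW.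
have q2 : 0 <= qdist K x0 / `|z0| by rewrite divr_ge0// ltW.
have h1 : opnorm i <= D.
  apply: (@le_trans _ _ (3 * (`|z0| / qdist K x0))); last first.
    by rewrite ler_wpM2l// lerDl.
  rewrite mulrA ler_pdivlMr//.
  apply: (@le_trans _ _ (opnorm i * inv_opnorm i * `|z0|)); last first.
    by rewrite ler_wpM2r// ltW.
  rewrite -mulrA; exact: (ler_wpM2l ou l0).
have h2 : inv_opnorm i <= D.
  apply: (@le_trans _ _ (3 * (qdist K x0 / `|z0|))); last first.
    by rewrite ler_wpM2l// lerDr.
  rewrite mulrA ler_pdivlMr//.
  apply: (@le_trans _ _ (opnorm i * inv_opnorm i * qdist K x0)); last first.
    by rewrite ler_wpM2r ?qdist_ge0// ltW.
  rewrite [opnorm i * _]mulrC -mulrA; exact: (ler_wpM2l ov u0).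
move=> x z /Gi[a Ka ->].
have -> : qdist K x = `|a|.
  by rewrite quot_normE -(subrK (s a) x) addrC qdist_shift.
split; first exact: le_trans (iu a) (ler_wpM2r (normr_ge0 _) h1).
exact: le_trans (il a) (ler_wpM2r (normr_ge0 _) h2).
Qed.

Lemma partial_embedding_start : exists z0 G, partial_embedding z0 G.
Proof.
have ls : linear (fun c : 'rV[R]_1 => c 0 0 *: x0).
  by move=> a c d; rewrite !mxE scalerDl scalerA.
pose s := linear_map ls.
have sK c : qdist K (s c) = 0 -> c = 0.
  move=> /Kclosed; have [c0 _|c0 /(subspaceZ Ksub (c 0 0)^-1)] := eqVneq (c 0 0) 0.
    by apply/rowP => i; rewrite ord1 c0 mxE.
  by rewrite /= scalerA mulVf// scale1r.
(* On the line of [x0], tolerance 1 gives distortion at most 2, which is below 3. *)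
have [u uP] := C_embeds (C_quot sK) ltr01.
exists (u (const_mx 1)), [set p |
  exists2 a : normed_rV (quot_norm Ksub sK), K (p.1 - s a) & p.2 = u a].
exists 1%N, s, sK, u.
have ul c : `|c| <= 1 * `|u c| by rewrite mul1r (uP c).1.
have uu c := (uP c).2.
split=> //; first exact: bounded_iso_embedding uu ul.
  by rewrite (le_lt_trans (distortion_le _ _ uu ul))// ?mulr1; lra.
by exists (const_mx 1) => //=; rewrite mxE scale1r.
Qed.

Lemma partial_embedding_extend z0 G y : partial_embedding z0 G ->
  exists G', [/\ partial_embedding z0 G', G `<=` G' & exists z, G' (y, z)].
Proof.
move=> PG; have [n [s [sK [i [ie id [a0 sa0 ia0] Gi]]]]] := PG.
(* If [y] is already in the span modulo [K], there is nothing to extend; otherwise it becomes a new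
   coordinate. *)
have [[a Ka]|ny] := pselect (exists a, K (y - s a)).
  by exists G; split=> //; exists (i a); apply/Gi; exists a.
have ls' : linear (fun c : 'rV[R]_(n + 1) => s (lsubmx c) + (rsubmx c) 0 0 *: y).
  move=> a c d; rewrite !linearP/= !mxE scalerDr scalerDl addrACA scalerA.
  by [].
pose s' := linear_map ls'.
have s'K c : qdist K (s' c) = 0 -> c = 0.
  move=> /Kclosed /=; set b := rsubmx c 0 0 => Kc.
  have b0 : b = 0.
    apply/eqP; apply: contrapT => /negP b0; apply: ny; exists (- b^-1 *: lsubmx c).
    have := subspaceZ Ksub b^-1 Kc.
    by rewrite scalerDr scalerA mulVf// scale1r linearZ/= scaleNr opprK addrC.
  have l0 : lsubmx c = 0.
    apply: (sK); move: Kc; rewrite b0 scale0r addr0 => Kc.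
    apply/eqP; rewrite eq_le qdist_ge0// andbT.
    by have := qdist_le Ksub (s (lsubmx c)) Kc; rewrite subrr normr0.
  rewrite -[c]hsubmxK l0 [rsubmx c]mx11_scalar -/b b0.
  by apply/rowP => k; rewrite !mxE; case: splitP => k' _; rewrite !mxE ?mul0rn.
pose A := normed_rV (quot_norm Ksub sK).
pose B := normed_rV (quot_norm Ksub s'K).
have lj : linear (fun c : A => row_mx c 0 : B).
  move=> a c d; rewrite -[RHS]/(a *: row_mx c 0 + row_mx d 0 : 'rV[R]_(n + 1)).
  by rewrite scale_row_mx add_row_mx scaler0 addr0.
pose j := linear_map lj.
have s'j c : s' (j c) = s c by rewrite /= row_mxKl row_mxKr mxE scale0r addr0.
have jn : isometric_embedding j by move=> c; rewrite !quot_normE s'j.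
have d0 := distortion_ge0 ie.
(* Chosen so that [1 + e] times the distortion is still strictly below 3; the denominator is
   positive even if the distortion is 0. *)
pose e := (3 - distortion i) / (2 * distortion i + 1).
have dd : 0 < 2 * distortion i + 1 by rewrite ltr_wpDl// mulr_ge0.
have e0 : 0 < e by rewrite divr_gt0// subr_gt0.
(* The disposition property concerns nonzero spaces; the coordinates of [x0] provide the nonzero
   vector. *)
have A0 : exists a : A, a != 0.
  exists a0; apply/eqP => a00; apply: x0K.
  by rewrite -sa0 a00 linear0; case: Ksub.
have [i' [i'e i'j i'd]] := C_disposition (C_quot sK) (C_quot s'K) A0 jn e0 ie.
exists [set p | exists2 a : B, K (p.1 - s' a) & p.2 = i' a]; split.
- exists (n + 1)%N, s', s'K, i'; split=> //; last first.
    by exists (j a0); rewrite ?s'j ?i'j.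
  rewrite (le_lt_trans i'd)// /e.
  have -> : (1 + (3 - distortion i) / (2 * distortion i + 1)) * distortion i =
      3 - (3 - distortion i) * (distortion i + 1) / (2 * distortion i + 1).
    by field; rewrite gt_eqF.
  by rewrite ltrBlDr ltrDl divr_gt0// mulr_gt0 ?subr_gt0// ltr_wpDl.
- move=> [x z] /Gi[a Ka ->]; exists (j a); last by rewrite i'j.
  by change (K (x - s' (j a))); rewrite s'j.
- exists (i' (row_mx 0 1%:M)), (row_mx 0 1%:M) => //=.
  rewrite row_mxKl row_mxKr linear0 mxE eqxx scale1r add0r subrr.
  by case: Ksub.
Qed.

(** Extending along [y] one vector at a time gives an increasing sequence of graphs. When [y] is
    dense, their union is the graph of an embedding of a dense part of [E / K]. *)
Lemma quotient_embedding (y : nat -> E) : exists (G : set (E * E)) (D : R),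
  [/\ subspace_of G, forall k, K k -> G (k, 0), forall n, exists z, G (y n, z) &
    forall x z, G (x, z) -> `|z| <= D * qdist K x /\ qdist K x <= D * `|z|].
Proof.
have [z0 [G0 PG0]] := partial_embedding_start.
pose T := {G | partial_embedding z0 G}.
have next (p : nat * T) : exists q : T,
    sval p.2 `<=` sval q /\ exists z, sval q (y p.1, z).
  case: p => n [G PG] /=.
  have [G' [PG' GG' yG']] := partial_embedding_extend (y n) PG.
  by exists (exist _ G' PG').
have [f fP] := choice next.
pose g := fix g n : T := if n is m.+1 then f (m, g m) else exist _ G0 PG0.
have gmono m n : (m <= n)%N -> sval (g m) `<=` sval (g n).
  elim: n => [|n IH]; first by rewrite leqn0 => /eqP ->.
  rewrite leq_eqVlt => /orP[/eqP -> //|/IH h].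
  exact: subset_trans h (fP (n, g n)).1.
(* The witness for [D] is left open; the last goal supplies the constant common to all stages. *)
exists (\bigcup_n sval (g n)); eexists; split.
- have glin n := partial_embedding_linear (svalP (g n)).
  split=> [|a p q [m _ mp] [n _ nq]]; first by exists 0%N => //; case: (glin 0%N).
  exists (maxn m n) => //; case: (glin (maxn m n)) => _; apply.
    by apply: gmono mp; exact: leq_maxl.
  by apply: gmono nq; exact: leq_maxr.
- by move=> k Kk; exists 0%N => //; exact: partial_embedding0 (svalP (g 0%N)) Kk.
- by move=> n; have [_ [z Gz]] := fP (n, g n); exists z, n.+1.
- by move=> x z [n _ Gn]; exact: partial_embedding_bounds (svalP (g n)) _ _ Gn.
Qed.

End EmbeddingTheQuotient.

(** * Annihilators, the bipolar theorem and the adjoint surjection *)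

Section Annihilators.
Context {R : realType} (E : normedModType R).

Definition preannihilator (V : set (dual E)) : set E :=
  [set x | forall f : dual E, V f -> f x = 0].

Lemma preannihilator_subspace (V : set (dual E)) : subspace_of (preannihilator V).
Proof.
split=> [f _|a x y Kx Ky f Vf]; first by rewrite linear0.
by rewrite linearP/= Kx// Ky// scaler0 addr0.
Qed.

Lemma annihilator_qdist_le (K : set E) (f : dual E) x : subspace_of K ->
  (forall z, K z -> f z = 0) -> `|f x| <= `|f| * qdist K x.
Proof.
move=> Ks fK; have [f0|f0] := eqVneq `|f| 0.
  by rewrite f0 mul0r -(mul0r `|x|) -f0 dual_ub.
have fp : 0 < `|f| by rewrite lt_neqAle eq_sym f0 normr_ge0.
rewrite -ler_pdivrMl//; apply: le_qdist => // z Kz; rewrite ler_pdivrMl//.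
by rewrite -[f x]subr0 -(fK z Kz) -linearB dual_ub.
Qed.

Lemma preannihilator_closed (V : set (dual E)) x :
  qdist (preannihilator V) x = 0 -> preannihilator V x.
Proof.
move=> x0 f Vf; apply/eqP; rewrite -normr_le0.
rewrite (le_trans (annihilator_qdist_le (f := f) x
  (preannihilator_subspace V) _))//.
  by move=> z; exact.
by rewrite x0 mulr0.
Qed.

Lemma closed_qdist0 (M : normedModType R) (V : set M) x : subspace_of V ->
  closed V -> qdist V x = 0 -> V x.
Proof.
move=> Vs Vc x0; apply: Vc => A /nbhs_ballP[e /= e0 eA].
have [z Vz xz] : exists2 z, V z & `|x - z| < e by apply: qdist_lt => //; rewrite x0.
by exists z; split=> //; apply: eA; rewrite -ball_normE.
Qed.

(** Otherwise some functional [phi] on the dual vanishes on [V] and is 1 at [g]. By reflexivity it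
    is the evaluation at some [x], which lies in the preannihilator of [V]; hence [g x = 0], a
    contradiction. *)
Lemma reflexive_bipolar (V : set (dual E)) (g : dual E) : reflexive_space E ->
  subspace_of V -> closed V -> (forall x, preannihilator V x -> g x = 0) -> V g.
Proof.
move=> Er Vs Vc gK; apply: contrapT => Vg; apply: Vg; apply: closed_qdist0 => //.
apply: contrapT => /eqP d0; have d_gt0 : 0 < qdist V g.
  by rewrite lt_neqAle eq_sym d0 qdist_ge0.
(* The graph of [v + r *: g |-> r] for [v] in [V]. It is dominated because such a vector is at
   distance [|r| * qdist V g] from [V]. *)
pose G : set (dual E * R) := [set p | V (p.1 - p.2 *: g)].
have Gd : dominated_graph (qdist V g)^-1 G.
  split; rewrite /G/=.
  - by rewrite scale0r subr0; case: Vs.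
  - move=> a f r h s Vf Vh.
    rewrite scalerDl -scalerA opprD addrACA -scalerBr; case: Vs => _; exact.
  - move=> f r Vf; rewrite ler_pdivlMl//.
    rewrite (le_trans (y := `|r| * qdist V g))//.
      by rewrite mulrC; apply: ler_wpM2r; [exact: ltW|exact: ler_norm].
    rewrite -qdistZ// -(qdist_shift Vs (r *: g) Vf) addrC subrK.
    exact: qdist_le_norm.
have dV : 0 <= (qdist V g)^-1 by rewrite invr_ge0 ltW.
have [phi [phiG _]] := hahn_banach_graph dV Gd.
have [x xphi] := Er phi.
have gx : g x = 0.
  apply: gK => f Vf; rewrite -xphi; apply: phiG.
  by rewrite /G/= scale0r subr0.
have : phi g = 1 by apply: phiG; rewrite /G/= scale1r subrr; case: Vs.
by rewrite xphi gx => /esym/eqP; rewrite oner_eq0.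
Qed.

Lemma dual_eq_dense (D : set E) (f g : dual E) : dense D ->
  (forall x, D x -> f x = g x) -> f = g.
Proof.
move=> Dd fg; apply/eqP; rewrite -subr_eq0.
have : forall x, D x -> (f - g : dual E) x = 0.
  by move=> x Dx; rewrite dualDE fg//; exact: subrr.
move: (f - g) => h h0; apply/eqP/val_inj/funext => x; change (h x = 0).
apply/eqP; rewrite -normr_le0; apply/ler_addgt0Pr => e e0; rewrite add0r.
have n1 : 0 < `|h| + 1 by rewrite ltr_wpDl.
have [|z [xz Dz]] := Dd (ball x (e / (`|h| + 1))) _ (ball_open _ _).
  by exists x; apply: ballxx; rewrite divr_gt0.
have -> : h x = h (x - z) by rewrite -[LHS]subr0 -(h0 z Dz) -linearB.
move: xz; rewrite -ball_normE/= => xz.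
rewrite (le_trans (dual_ub _ _))//.
rewrite (@le_trans _ _ ((`|h| + 1) * `|x - z|))//.
  by rewrite ler_wpM2r// lerDl.
by rewrite -ler_pdivlMl// mulrC ltW.
Qed.

End Annihilators.


Lemma separable_dense_seq (R : realType) (E : normedModType R) :
  separable E -> exists y : nat -> E, dense (range y).
Proof.
move=> [D Dc Dd]; have [D0|[f]] := pfcard_geP Dc; last first.
  by exists f; rewrite image_eq.
have [|x []] := Dd setT _ openT; first by exists 0.
by rewrite D0.
Qed.

(** [G] is the graph of an embedding [i] of a dense part of the quotient by the preannihilator. The
    surjection is [f |-> f \o i], extended to [E] by Hahn-Banach and unique by density; for [g] in
    [V], the functional [g \o i^-1] on the range of [i] extends to a preimage of [g]. *)
Lemma quotient_embedding_surjection (R : realType) (E : normedModType R)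
    (V : set (dual E)) (G : set (E * E)) (D : R) (y : nat -> E) :
  reflexive_space E -> subspace_of V -> closed V ->
  subspace_of G -> (forall x, preannihilator V x -> G (x, 0)) ->
  dense (range y) -> (forall n, exists z, G (y n, z)) ->
  (forall x z, G (x, z) -> `|z| <= D * qdist (preannihilator V) x /\
    qdist (preannihilator V) x <= D * `|z|) ->
  exists T : {linear dual E -> dual E}, continuous T /\ range T = V.
Proof.
move=> Er Vs Vc [G0 GD] GK yd yG Gb.
have Ks := preannihilator_subspace V.
pose C := `|D|; have C0 : 0 <= C by exact: normr_ge0.
have CD (r : R) : 0 <= r -> D * r <= C * r.
  by move=> r0; rewrite ler_wpM2r// ler_norm.
pose pullback (f g : dual E) := forall x z, G (x, z) -> g x = f z.
have pullback_ex f : exists g : dual E, pullback f g /\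
    forall x, `|g x| <= (C * `|f|) * `|x|.
  pose H : set (E * R) := [set p | exists2 z, G (p.1, z) & p.2 = f z].
  have [||g [gH gb]] := @hahn_banach_graph R E (C * `|f|) _ H.
  - by rewrite mulr_ge0.
  - split; rewrite /H/=.
    + by exists 0 => //; rewrite linear0.
    + move=> a x _ x' _ [z Gz ->] [z' Gz' ->]; exists (a *: z + z').
        exact: (GD a _ _ Gz Gz').
      by rewrite linearP.
    + move=> x _ [z Gz ->]; rewrite (le_trans (ler_norm _))//.
      rewrite (le_trans (dual_ub _ _))// mulrAC mulrC ler_wpM2r//.
      rewrite (le_trans (Gb _ _ Gz).1)// (le_trans (CD _ (qdist_ge0 Ks x)))//.
      by apply: (ler_wpM2l C0); exact: qdist_le_norm.
  by exists g; split=> // x z Gz; apply: gH; exists z.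
have [T TP] := choice pullback_ex.
have pullback_uniq f g h : pullback f g -> pullback f h -> g = h.
  move=> fg fh; apply: (dual_eq_dense yd) => _ [n _ <-].
  by have [z Gz] := yG n; rewrite (fg _ _ Gz) (fh _ _ Gz).
(* [T] comes from a choice; its linearity follows from the uniqueness of pullbacks. *)
have Tlin : linear T.
  move=> a f g; apply: (pullback_uniq (a *: f + g)); first exact: (TP _).1.
  by move=> x z Gz; rewrite !dualDE !dualZE ((TP f).1 _ _ Gz) ((TP g).1 _ _ Gz).
exists (linear_map Tlin); split.
  apply: (@bounded_continuous _ _ _ _ C) => f.
  by apply: dual_norm_le_bound; [rewrite mulr_ge0|exact: (TP f).2].
apply/seteqP; split=> [_ [f _ <-]|g Vg].
  (* [G] relates the preannihilator to 0, so [T f] vanishes there and lies in [V] by the bipolar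
     theorem. *)
  apply: reflexive_bipolar => // x /GK Gx.
  by rewrite /= ((TP f).1 _ _ Gx) linear0.
(* The relation [z |-> g x] is dominated: [g] vanishes on the preannihilator, so [g x] is controlled
   by the distance of [x] to it, which the norm of [z] controls in turn. *)
pose H : set (E * R) := [set p | exists2 x, G (x, p.1) & p.2 = g x].
have [||h [hH _]] := @hahn_banach_graph R E (C * `|g|) _ H.
- by rewrite mulr_ge0.
- split; rewrite /H/=.
  + by exists 0 => //; rewrite linear0.
  + move=> a z _ z' _ [x Gx ->] [x' Gx' ->]; exists (a *: x + x').
      exact: (GD a _ _ Gx Gx').
    by rewrite linearP.
  + move=> z _ [x Gx ->]; rewrite (le_trans (ler_norm _))//.
    have gK w : preannihilator V w -> g w = 0 by exact.
    rewrite (le_trans (annihilator_qdist_le x Ks gK))// mulrAC mulrC ler_wpM2r//.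
    by rewrite (le_trans (Gb _ _ Gx).2)// CD.
exists h => //=; apply: (pullback_uniq h); first exact: (TP h).1.
by move=> x z Gz; apply/esym/hH; exists x.
Qed.

Theorem theorem16 (R : realType) (X : completeNormedModType R)
    (hclosed : star_star_closed (finite_class X))
    (hsuper : superreflexive (finite_class X))
    (E : completeNormedModType R)
    (hE : finite_class X E)
    (hsep : separable E)
    (haud : almost_universal_disposition (minkowski_base X) E) :
  surjection_property (dual E).
Proof.
move=> V [V0 VD] Vc.
have Vs : subspace_of V.
  split=> [|a f g Vf Vg]; first exact: set_mem.
  by apply: set_mem; apply: VD; exact: mem_set.
have [W [Z [WZ XZ]]] := hclosed.
have {}XZ : finitely_equivalent X Z by apply/XZ; exact: finitely_equivalent_refl.
have Ks := preannihilator_subspace V.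
(* If the preannihilator is everything, [V] is zero and the zero map works; otherwise a point
   outside it starts the construction. *)
have [[x0 x0K]|Kall] := pselect (exists x0, ~ preannihilator V x0); last first.
  exists (\0 : {linear dual E -> dual E}); split; first exact: cst_continuous.
  apply/seteqP; split=> [_ [f _ <-]|f Vf]; first by case: Vs.
  exists 0 => //; apply/val_inj/funext => x; change (0 = f x).
  by apply/esym; apply: contrapT => fx; apply: Kall; exists x => /(_ f Vf).
have [y yd] := separable_dense_seq hsep.
have C_quot := quot_norm_mem_minkowski_base WZ XZ hE.2.
have C_embeds A : minkowski_base X A -> almost_embeds A E.
  by move=> /(minkowski_base_representable hE.1)/minkowski_baseP[].
have [G [D [Gs GK Gy Gb]]] := quotient_embedding
  (@preannihilator_closed _ _ V) (fun n s sK => C_quot n s _ Ks sK)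
  C_embeds haud x0K y.
exact: (quotient_embedding_surjection (hsuper E hE) Vs Vc Gs GK yd Gy Gb).
Qed.
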